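(* Let $\alpha>0$, and let $\mathcal X,\mathcal Y$ be separable metric spaces. Let $(\mathbf X,\mathbf Y)$ and $(\mathbf X^{(n)},\mathbf Y^{(n)})$, $n\ge1$, be pairs of random variables in $\mathcal X\times\mathcal Y$, and assume that, as $n\to\infty$, $(\mathbf X^{(n)},\mathbf Y^{(n)})\to(\mathbf X,\mathbf Y)$ in distribution. Assume further one of the following two conditions: (i) the sequences $\|\mathbf X^{(n)}\|^{\alpha^*}$ and $\|\mathbf Y^{(n)}\|^{\alpha^*}$ are uniformly integrable; (ii) $\mathbb E\|\mathbf X^{(n)}\|^{\alpha^*}\to\mathbb E\|\mathbf X\|^{\alpha^*}<\infty$ and $\mathbb E\|\mathbf Y^{(n)}\|^{\alpha^*}\to\mathbb E\|\mathbf Y\|^{\alpha^*}<\infty$. Then $\mathrm{dcov}_\alpha(\mathbf X^{(n)},\mathbf Y^{(n)})\to\mathrm{dcov}_\alpha(\mathbf X,\mathbf Y)$ as $n\to\infty$.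
   Context: Both metrics are denoted $d$. Fix points $\mathbf x_o\in\mathcal X$, $\mathbf y_o\in\mathcal Y$ and write $\|\mathbf x\|:=d(\mathbf x,\mathbf x_o)$, $\|\mathbf y\|:=d(\mathbf y,\mathbf y_o)$. Put $\alpha^*:=\max(\alpha,2\alpha-2)$. For a pair $(\mathbf X,\mathbf Y)$ with $\mathbb E\|\mathbf X\|^{\alpha^*}<\infty$ and $\mathbb E\|\mathbf Y\|^{\alpha^*}<\infty$, the $\alpha$-distance covariance is $\mathrm{dcov}_\alpha(\mathbf X,\mathbf Y):=\frac14\mathbb E[\widehat X_\alpha\widehat Y_\alpha]$, where $(\mathbf X_i,\mathbf Y_i)$, $i\ge1$, are independent copies of $(\mathbf X,\mathbf Y)$, $\widehat X_\alpha:=d(\mathbf X_1,\mathbf X_2)^\alpha-d(\mathbf X_2,\mathbf X_3)^\alpha+d(\mathbf X_3,\mathbf X_4)^\alpha-d(\mathbf X_4,\mathbf X_1)^\alpha$, and $\widehat Y_\alpha$ is defined in the same way with $\mathbf Y_i$ in place of $\mathbf X_i$. It depends only on the joint distribution of $(\mathbf X,\mathbf Y)$. Under either condition (i) or (ii) these moments are finite for $(\mathbf X,\mathbf Y)$ and for $(\mathbf X^{(n)},\mathbf Y^{(n)})$ with $n$ large, so the quantities in the conclusion are defined for all large $n$. *)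

(* Defs.v *)
From mathcomp Require Import all_boot all_order all_algebra.
From mathcomp Require Import all_classical all_reals all_analysis.

Set Implicit Arguments.
Unset Strict Implicit.
Unset Printing Implicit Defensive.

Import Order.TTheory GRing.Theory Num.Theory.
Import numFieldNormedType.Exports.

Local Open Scope classical_set_scope.
Local Open Scope ring_scope.

Definition separable (T : topologicalType) : Prop :=
  exists2 D : set T, countable D & dense D.

(* [measurableType] extends [pointedType], whereas a topological space carries
   no canonical point; Borel measurability is therefore stated directly with
   the sigma-algebra generated by the open sets rather than with a
   [measurableType] instance on [S]. *)
Definition borel_measurable (d : measure_display) (Omega : measurableType d)
    (S : topologicalType) (X : Omega -> S) : Prop :=
  forall B : set S, <<s (@open S) >> B -> measurable (X @^-1` B).

(* The variables [Z_ n] may live on different probability spaces. *)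
Definition cvg_in_distribution (R : realType) (S : topologicalType)
    (d_ : nat -> measure_display) (Omega_ : forall n, measurableType (d_ n))
    (P_ : forall n, probability (Omega_ n) R) (Z_ : forall n, Omega_ n -> S)
    (d : measure_display) (Omega : measurableType d) (P : probability Omega R)
    (Z : Omega -> S) : Prop :=
  forall f : S -> R, continuous f -> bounded_fun f ->
    (fun n => 'E_(P_ n)[f \o Z_ n])%E @ \oo --> 'E_P[f \o Z]%E.

Definition uniformly_integrable (R : realType)
    (d_ : nat -> measure_display) (Omega_ : forall n, measurableType (d_ n))
    (P_ : forall n, probability (Omega_ n) R) (Z_ : forall n, Omega_ n -> R) :
    Prop :=
  ereal_sup [set (\int[P_ n]_(w in [set w | (c < `|Z_ n w|)%R]) `|Z_ n w|%:E)%E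
            | n in [set: nat]] @[c --> +oo%R] --> 0%E.

Definition alpha_star (R : realType) (alpha : R) : R :=
  Num.max alpha (2 * alpha - 2).

Definition hat (R : realType) (T : metricType R) (alpha : R)
    (x1 x2 x3 x4 : T) : R :=
  mdist x1 x2 `^ alpha - mdist x2 x3 `^ alpha
  + mdist x3 x4 `^ alpha - mdist x4 x1 `^ alpha.

(* Four independent copies of [(X, Y)] are realized on [Omega ^ 4] under the
   product measure, as [(X w_i, Y w_i)] for the coordinates [w_i].
   The value is an extended real, so that a non-finite expectation is not
   identified with a real number. *)
Definition dcov (R : realType) (TX TY : metricType R) (alpha : R)
    (d : measure_display) (Omega : measurableType d) (P : probability Omega R)
    (X : Omega -> TX) (Y : Omega -> TY) : \bar R :=
  (4^-1%:E * \int[P \x P \x P \x P]_w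
    let: (w1, w2, w3, w4) := w in
    (hat alpha (X w1) (X w2) (X w3) (X w4)
     * hat alpha (Y w1) (Y w2) (Y w3) (Y w4))%:E)%E.

(* Main.v *)
(* With [e = alpha_star alpha / 2] and [|x| = max 1 (d x xo)], pairing the four
   terms of [hat] through the smaller of the scales of [{x1, x3}] and
   [{x2, x4}] gives [|hat x1 x2 x3 x4| <= C (|x1| |x2| |x3| |x4|)^e], so the
   integrand of [dcov] is dominated by a product over the four independent
   copies of the weight [2 + d(x, xo)^alpha_star + d(y, yo)^alpha_star].  Either
   moment condition makes the excess of this weight over a large level
   uniformly small, hence [d] may be replaced by the metric [min d M], which
   makes the integrand bounded and uniformly continuous.  For such functions,
   weak convergence passes to product measures: on a separable space a
   continuous partition of unity approximates the integrand by finite sums of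
   products of functions of separate coordinates, up to a bounded error
   supported on the uncovered part of the space, whose probability is small in
   the limit. *)

Require Import Defs.
From mathcomp Require Import all_boot all_order all_algebra.
From mathcomp Require Import all_classical all_reals all_analysis.
From mathcomp Require Import measurable_realfun ring lra.

Import Order.TTheory GRing.Theory Num.Theory.
Import numFieldNormedType.Exports.

Local Open Scope classical_set_scope.
Local Open Scope ring_scope.

(** * Power inequalities *)

(** The exponent comes from the product of the two kernels. Each copy contributes [|x|^e |y|^e],
    which the arithmetic-geometric mean inequality bounds by marginal moments of order [2e], so no
    mixed moment enters; the bound on [hat] requires [alpha <= 2e] and [alpha - 1 <= e], and the
    smallest such [2e] is [alpha_star].

    The truncation acts on the metric because [min d M] is again a nonnegative 1-Lipschitz function
    of [d], at most [d]: the same domination then holds for the truncated kernel, with a constant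
    independent of [M].

    Completeness is not assumed, so even a single law need not be tight. Tightness is replaced by a
    test function: the uncovered part is measured by a bounded continuous function, whose integral
    is small for the limit law and hence, by weak convergence, for the laws of large index. Since
    the variables live on different probability spaces, every estimate is made on integrals. *)

Lemma powR_sub_le1 (R : realType) (al a b : R) : 0 < al -> al <= 1 ->
  0 <= b -> b <= a -> a `^ al - b `^ al <= (a - b) `^ al.
Proof.
move=> al0 al1 b0 ba.
have [a0|a0] := eqVneq a 0.
  have -> : b = 0 by apply/eqP; rewrite eq_le b0 andbT -a0.
  by rewrite a0 !subrr powR_ge0.
have {}a0 : 0 < a by rewrite lt_neqAle eq_sym a0 (le_trans b0).
(* By homogeneity the claim is [1 - t^al <= (1 - t)^al] on [[0, 1]], which follows from [t <= t^al]
   and [1 - t <= (1 - t)^al]. *)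
pose t := b / a.
have t0 : 0 <= t by rewrite divr_ge0// ltW.
have t1 : t <= 1 by rewrite ler_pdivrMr// mul1r.
have tE : b = a * t by rewrite /t mulrCA divff ?mulr1// gt_eqF.
have le_powR (x : R) : 0 <= x -> x <= 1 -> x <= x `^ al.
  move=> x0 x1; have [->|xn0] := eqVneq x 0; first by rewrite powR_ge0.
  by apply: ger1_powR => //; rewrite x1 andbT lt_neqAle eq_sym xn0.
have -> : a - b = a * (1 - t) by rewrite mulrBr mulr1 -tE.
have t1' : 0 <= 1 - t by rewrite subr_ge0.
rewrite tE (powRM _ (ltW a0) t0) (powRM _ (ltW a0) t1').
rewrite -{1}[a `^ al]mulr1 -mulrBr.
rewrite ler_pM2l ?powR_gt0// lerBlDr.
have := le_powR (1 - t); have := le_powR t t0 t1.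
by rewrite subr_ge0 lerBlDr lerDl => ? /(_ t1 t0); lra.
Qed.

(** Bernoulli's inequality: the convex function [t ^+ n] lies above its tangent at [1]. *)
Lemma expr_ge_tangent (R : realFieldType) (t : R) (n : nat) :
  0 <= t -> t <= 1 -> 1 - n%:R * (1 - t) <= t ^+ n.
Proof.
move=> t0 t1; elim: n => [|n IH]; first by rewrite mul0r subr0 expr0.
rewrite exprS -natr1; apply: le_trans (ler_wpM2l t0 IH).
have : 0 <= n%:R * (1 - t) * (1 - t) :> R by rewrite !mulr_ge0 ?subr_ge0.
by nra.
Qed.

(** A mean value estimate without derivatives: the ratio [t = b / a] satisfies [t^n <= t^al] because
    [al <= n], and Bernoulli's inequality handles the integer power. The price is the constant [n]
    in place of [al]. *)
Lemma powR_sub_ge1 (R : realType) (al a b : R) (n : nat) : 1 <= al ->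
  al <= n%:R -> 0 <= b -> b <= a ->
  a `^ al - b `^ al <= n%:R * a `^ (al - 1) * (a - b).
Proof.
move=> al1 aln b0 ba.
have [a0|a0] := eqVneq a 0.
  have -> : b = 0 by apply/eqP; rewrite eq_le b0 andbT -a0.
  by rewrite a0 !subrr mulr0.
have {}a0 : 0 < a by rewrite lt_neqAle eq_sym a0 (le_trans b0).
pose t := b / a.
have t0 : 0 <= t by rewrite divr_ge0// ltW.
have t1 : t <= 1 by rewrite ler_pdivrMr// mul1r.
have tE : b = a * t by rewrite /t mulrCA divff ?mulr1// gt_eqF.
have tn : t ^+ n <= t `^ al.
  have [tz|tn0] := eqVneq t 0.
    rewrite tz powR0 ?expr0n; last by rewrite gt_eqF// (lt_le_trans _ al1).
    by case: eqP aln => // -> ; lra.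
  rewrite -powR_mulrn//; apply: ger_powR => //.
  by rewrite t1 andbT lt_neqAle eq_sym tn0.
have -> : a - b = a * (1 - t) by rewrite mulrBr mulr1 -tE.
have aE : a * a `^ (al - 1) = a `^ al.
  by rewrite mulr_powRB1// ?(ltW a0)// (lt_le_trans _ al1).
rewrite tE (powRM _ (ltW a0) t0) -{1}[a `^ al]mulr1 -mulrBr.
have -> : n%:R * a `^ (al - 1) * (a * (1 - t)) = a `^ al * (n%:R * (1 - t)).
  by rewrite -aE; ring.
rewrite ler_pM2l ?powR_gt0//.
by have := expr_ge_tangent _ _ n t0 t1; lra.
Qed.

(* [e = alpha_star al / 2] works because [al <= 2 e] and [al - 1 <= e]. *)
Lemma powR_dist_bound (R : realType) (al e : R) : 0 < al ->
  al <= 2 * e -> al - 1 <= e ->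
  exists2 C, 0 <= C & forall U V a b : R, 1 <= U -> U <= V ->
  0 <= a -> 0 <= b -> a <= 2 * V -> b <= 2 * V -> `|a - b| <= 2 * U ->
  `|a `^ al - b `^ al| <= C * (U * V) `^ e.
Proof.
move=> al0 ale ale1; have e0 : 0 <= e by lra.
have two0 : (0 : R) <= 2 by lra.
pose n := (Num.truncn al).+1.
have aln : al <= n%:R by apply: ltW; rewrite truncnS_gt.
exists ((n%:R + 1) * 2 `^ al) => [|U V].
  by rewrite mulr_ge0 ?powR_ge0// addr_ge0.
suff key a b : 1 <= U -> U <= V -> 0 <= b -> b <= a -> a <= 2 * V ->
    a - b <= 2 * U ->
    a `^ al - b `^ al <= (n%:R + 1) * 2 `^ al * (U * V) `^ e.
  move=> a b U1 UV a0 b0 aV bV ab.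
  have /andP[ab1 ab2] : - (2 * U) <= a - b <= 2 * U by rewrite -ler_norml.
  have [ba|/ltW ba] := leP b a.
    rewrite ger0_norm; first exact: key.
    by rewrite subr_ge0 ge0_ler_powR// ?nnegrE// ltW.
  rewrite distrC ger0_norm; first by apply: key => //; lra.
  by rewrite subr_ge0 ge0_ler_powR// ?nnegrE// ltW.
move=> U1 UV b0 ba aV ab.
have U0 : 0 <= U by lra.
have V0 : 0 <= V by lra.
have V1 : 1 <= V by lra.
rewrite powRM//.
have Ue1 : 0 <= U `^ e by apply: powR_ge0.
have Ve1 : 0 <= V `^ e by apply: powR_ge0.
(* For [al <= 1] the difference is at most [(2U)^al], and [U^al <= U^(2e) <= U^e V^e]. *)
have [al1|/ltW al1] := leP al 1.
  apply: le_trans (powR_sub_le1 _ _ _ _ al0 al1 b0 ba) _.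
  apply: (@le_trans _ _ ((2 * U) `^ al)).
    by apply: ge0_ler_powR; rewrite ?nnegrE ?subr_ge0 ?mulr_ge0// ltW.
  rewrite powRM// -mulrA mulrCA ler_pM2l ?powR_gt0//.
  apply: (@le_trans _ _ (U `^ e * V `^ e)).
    apply: (@le_trans _ _ (U `^ (e + e))); first by apply: ler_powR => //; lra.
    rewrite powRD; last by apply/implyP => _; rewrite gt_eqF//; lra.
    by rewrite ler_wpM2l// ge0_ler_powR ?nnegrE.
  by rewrite -[leLHS]mul1r ler_wpM2r ?mulr_ge0// lerDr.
apply: le_trans (powR_sub_ge1 _ _ _ _ n al1 aln b0 ba) _.
apply: (@le_trans _ _ (n%:R * (2 * V) `^ (al - 1) * (2 * U))).
  apply: ler_pM => //; [by rewrite mulr_ge0 ?powR_ge0|by rewrite subr_ge0|].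
  rewrite ler_wpM2l// ge0_ler_powR ?nnegrE ?subr_ge0 ?mulr_ge0//.
  exact: le_trans ba.
have -> : n%:R * (2 * V) `^ (al - 1) * (2 * U) =
    n%:R * 2 `^ al * (U * V `^ (al - 1)).
  rewrite powRM//.
  have -> : 2 `^ al = 2 * 2 `^ (al - 1) :> R by rewrite mulr_powRB1.
  by ring.
apply: ler_pM.
- by rewrite mulr_ge0// powR_ge0.
- by rewrite mulr_ge0// powR_ge0.
- by rewrite ler_wpM2r ?powR_ge0// lerDl.
(* The exponent [al - 1 - e] is nonpositive, so [V] may be lowered to [U] in that power; what
   remains is [U^(al - e) <= U^e]. *)
have -> : al - 1 = e + (al - 1 - e) by ring.
rewrite powRD; last by apply/implyP => _; rewrite gt_eqF//; lra.
rewrite mulrCA [leRHS]mulrC ler_wpM2l//.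
have VU : V `^ (al - 1 - e) <= U `^ (al - 1 - e).
  have -> : al - 1 - e = - (e - al + 1) by ring.
  rewrite !powRN lef_pV2 ?posrE ?powR_gt0//; try lra.
  by rewrite ge0_ler_powR ?nnegrE//; lra.
apply: (@le_trans _ _ (U * U `^ (al - 1 - e))); first by rewrite ler_wpM2l.
rewrite -{1}(powRr1 U0) -powRD; last first.
  by apply/implyP => _; rewrite gt_eqF//; lra.
by apply: ler_powR => //; lra.
Qed.

(** Hölder continuity for [al <= 1], Lipschitz continuity on [[0, M]] for [al >= 1]. *)
Lemma powR_unif_cont (R : realType) (al M e : R) : 0 < al -> 0 <= M -> 0 < e ->
  exists2 del, 0 < del & forall a b : R, 0 <= a -> 0 <= b -> a <= M -> b <= M ->
  `|a - b| < del -> `|a `^ al - b `^ al| <= e.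
Proof.
move=> al0 M0 e0.
pose n := (Num.truncn al).+1.
have aln : al <= n%:R by apply: ltW; rewrite truncnS_gt.
suff [del del0 key] : exists2 del, 0 < del & forall a b : R, 0 <= b -> b <= a ->
    a <= M -> a - b < del -> a `^ al - b `^ al <= e.
  exists del => // a b a0 b0 aM bM; have [ba|/ltW ba] := leP b a.
    rewrite !ger0_norm ?subr_ge0//; first exact: key.
    by rewrite ge0_ler_powR// ?nnegrE// ltW.
  rewrite distrC ger0_norm ?subr_ge0//.
  rewrite distrC ger0_norm ?subr_ge0//; first exact: key.
  by rewrite ge0_ler_powR// ?nnegrE// ltW.
have [al1|/ltW al1] := leP al 1.
  exists (e `^ al^-1) => [|a b b0 ba aM ab]; first exact: powR_gt0.
  apply: le_trans (powR_sub_le1 _ _ _ _ al0 al1 b0 ba) _.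
  have -> : e = (e `^ al^-1) `^ al.
    by rewrite -powRrM mulVf ?gt_eqF// powRr1// ltW.
  by rewrite ge0_ler_powR ?nnegrE ?powR_ge0 ?subr_ge0// ltW.
have c0 : 0 <= n%:R * M `^ (al - 1) by rewrite mulr_ge0 ?powR_ge0.
(* The [+ 1] keeps the denominator positive when the Lipschitz constant vanishes. *)
exists (e / (n%:R * M `^ (al - 1) + 1)) => [|a b b0 ba aM].
  by rewrite divr_gt0// ltr_wpDl.
rewrite ltr_pdivlMr ?ltr_wpDl// => ab.
apply: le_trans (powR_sub_ge1 _ _ _ _ n al1 aln b0 ba) _.
apply: le_trans (ltW ab); rewrite [leRHS]mulrC ler_wpM2r ?subr_ge0//.
apply: (@le_trans _ _ (n%:R * M `^ (al - 1))); last by rewrite lerDl.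
rewrite ler_wpM2l// ge0_ler_powR ?nnegrE ?subr_ge0//.
exact: le_trans ba.
Qed.

(** * Distance functions and bounded integrals *)

Lemma measurable_fun_lt_preimage (R : realType) (d : measure_display)
    (T : measurableType d) (f : T -> R) :
  (forall r, measurable [set x | f x < r]) -> measurable_fun setT f.
Proof.
move=> mf; apply: (measurability _ (RGenInftyO.measurableE R)).
move=> _ [_ [r ->] <-]; rewrite setTI.
have -> : f @^-1` `]-oo, r[%classic = [set x | f x < r] by
  apply/seteqP; split => x /=; rewrite in_itv.
exact: mf.
Qed.

Lemma open_mdist_ball (R : realType) (T : metricType R) (s : T) (r : R) :
  open [set x | mdist x s < r].
Proof.
rewrite openE => x /= xs; rewrite /interior /=.
have r0 : 0 < r - mdist x s by rewrite subr_gt0.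
apply: (filterS _ (nbhsx_ballx x _ r0)) => y; rewrite ballEmdist /=.
move=> xy; apply: le_lt_trans (metric_triangle _ x _) _.
by rewrite (metric_sym y x) -ltrBrDr.
Qed.

Lemma measurable_mdist (R : realType) (d : measure_display)
    (Omega : measurableType d) (T : metricType R) (X : Omega -> T) (s : T) :
  borel_measurable X -> measurable_fun setT (fun w => mdist (X w) s).
Proof.
move=> mX; apply: measurable_fun_lt_preimage => r.
apply: (mX [set x | mdist x s < r]).
by apply: sub_sigma_algebra; exact: open_mdist_ball.
Qed.

Lemma continuous_mdist (R : realType) (T : metricType R) (s : T) :
  continuous (fun x => mdist x s : R).
Proof.
move=> x; apply/(@cvgrPdist_le R R^o) => e e0.
apply: (filterS _ (nbhsx_ballx x _ e0)) => y; rewrite ballEmdist /= => xy.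
apply: le_trans (ltW xy); rewrite ler_norml lerNl opprB.
rewrite lerBlDr lerBlDr; apply/andP; split; last exact: metric_triangle.
by rewrite (metric_sym x y) metric_triangle.
Qed.

Lemma separable_seq (R : realType) (T : metricType R) (x0 : T) :
  separable T ->
  exists s : nat -> T, forall x del, 0 < del -> exists k, mdist x (s k) < del.
Proof.
move=> [D /countable_injP[f finj] Dd].
(* The injection of [D] into [nat] is inverted; indices that code no point of [D] get the default
   [x0]. *)
exists (fun k => xget x0 [set x | D x /\ f x = k]) => x del del0.
have [||y [/= yx Dy]] := Dd [set y | mdist y x < del].
- by exists x; rewrite /= mdistxx.
- exact: open_mdist_ball.
exists (f y); case: xgetP => [z _ [Dz fz]|/(_ y)]; last by case.
by have -> : z = y; [apply: finj; rewrite ?inE|rewrite metric_sym].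
Qed.

(** By the triangle inequality and density, [mdist a b < r] holds exactly when
    [mdist a (s k) + mdist b (s k) < r] for some [k]. Separability thus reduces the event to a
    countable union of events on distances to fixed points, and no sigma-algebra on the product of
    the spaces is needed. *)
Lemma measurable_mdist2 (R : realType) (d : measure_display)
    (Omega : measurableType d) (T : metricType R) (s : nat -> T)
    (A B : Omega -> T) :
  (forall x del, 0 < del -> exists k, mdist x (s k) < del) ->
  (forall t, measurable_fun setT (fun w => mdist (A w) t)) ->
  (forall t, measurable_fun setT (fun w => mdist (B w) t)) ->
  measurable_fun setT (fun w => mdist (A w) (B w)).
Proof.
move=> sd mA mB; apply: measurable_fun_lt_preimage => r.
have -> : [set w | mdist (A w) (B w) < r] =
    \bigcup_k [set w | mdist (A w) (s k) + mdist (B w) (s k) < r].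
  apply/seteqP; split => w /=.
    move=> ABr; have e0 : 0 < (r - mdist (A w) (B w)) / 2.
      by rewrite divr_gt0// subr_gt0.
    have [k Bk] := sd (B w) _ e0; exists k => //=.
    by have := metric_triangle (A w) (B w) (s k); lra.
  move=> [k _ /=]; apply: le_lt_trans.
  by rewrite (metric_sym (B w)) metric_triangle.
apply: bigcup_measurable => k _; rewrite -[X in measurable X]setTI.
have mAB := measurable_funD (mA (s k)) (mB (s k)).
have -> : [set w | mdist (A w) (s k) + mdist (B w) (s k) < r] =
    (fun w => mdist (A w) (s k) + mdist (B w) (s k)) @^-1` `]-oo, r[.
  by apply/seteqP; split => w /=; rewrite in_itv.
by apply: mAB => //; exact: measurable_itv.
Qed.

(** * Real-valued integrals against a probability *)

Section bounded_integrals.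
Context (R : realType) (d : measure_display) (T : measurableType d).
Variable P : probability T R.

Lemma bounded_integrable (f : T -> R) (B : R) : measurable_fun setT f ->
  (forall x, `|f x| <= B) -> P.-integrable setT (EFin \o f).
Proof.
move=> mf fB; apply: measurable_bounded_integrable => //.
  by apply: le_lt_trans (probability_le1 P measurableT) _; rewrite ltry.
exists B; split=> [|x Bx y _]; first exact: num_real.
exact: le_trans (fB y) (ltW Bx).
Qed.

Lemma Rintegral_bounded (f : T -> R) (B : R) : measurable_fun setT f ->
  (forall x, `|f x| <= B) -> `|\int[P]_x f x| <= B.
Proof.
move=> mf fB; have fi := bounded_integrable f B mf fB.
apply: le_trans (le_normr_Rintegral measurableT fi) _.
have -> : B = \int[P]_(x in setT) B.
  by rewrite Rintegral_cst// [X in fine X](probability_setT P) mulr1.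
apply: le_Rintegral => //.
- by apply: (bounded_integrable _ B);
    [exact: measurableT_comp|move=> x; rewrite normr_id].
- exact: finite_measure_integrable_cst.
Qed.

Lemma EFin_Rintegral (f : T -> R) : P.-integrable setT (EFin \o f) ->
  (\int[P]_x (f x)%:E)%E = (\int[P]_x f x)%:E.
Proof. by move=> fi; rewrite fineK//; exact: integrable_fin_num. Qed.

Lemma Rintegral_sum (n : nat) (f : nat -> T -> R) :
  (forall k, P.-integrable setT (EFin \o f k)) ->
  \int[P]_x (\sum_(k < n) f k x) = \sum_(k < n) \int[P]_x f k x.
Proof.
move=> fi.
have si m : P.-integrable setT (EFin \o (fun x => \sum_(k < m) f k x)).
  elim: m => [|m IH].
    rewrite (_ : _ \o _ = cst 0%E) ?integrable0//.
    by apply/funext => x /=; rewrite big_ord0.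
  rewrite (_ : _ \o _ = ((EFin \o (fun x => (\sum_(k < m) f k x)%R)) \+
    (EFin \o f m))%E); last by apply/funext => x /=; rewrite big_ord_recr.
  exact: integrableD.
elim: n => [|n IH].
  rewrite big_ord0; under eq_Rintegral do rewrite big_ord0.
  by rewrite Rintegral_cst// mul0r.
rewrite big_ord_recr/= -IH -RintegralD//.
by apply: eq_Rintegral => x _; rewrite big_ord_recr.
Qed.

End bounded_integrals.

(** * Fubini for products of functions of separate coordinates *)

Section product_integrals.
Context (R : realType) (d1 d2 : measure_display).
Context (T1 : measurableType d1) (T2 : measurableType d2).
Variables (Q : probability T1 R) (P : probability T2 R).

Lemma measurable_fun_mul_prod (f : T1 -> R) (g : T2 -> R) :
  measurable_fun setT f -> measurable_fun setT g ->
  measurable_fun setT (fun z : T1 * T2 => f z.1 * g z.2).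
Proof.
move=> mf mg; apply: measurable_funM.
  exact: (measurableT_comp mf measurable_fst).
exact: (measurableT_comp mg measurable_snd).
Qed.

Lemma integrable_prod_mul (f : T1 -> R) (g : T2 -> R) :
  Q.-integrable setT (EFin \o f) -> P.-integrable setT (EFin \o g) ->
  (Q \x P)%E.-integrable setT (EFin \o (fun z : T1 * T2 => f z.1 * g z.2)).
Proof.
move=> fi gi.
have mf : measurable_fun setT f.
  by apply/measurable_EFinP; exact: (measurable_int _ fi).
have mg : measurable_fun setT g.
  by apply/measurable_EFinP; exact: (measurable_int _ gi).
apply/integrable12ltyP.
  by apply/measurable_EFinP; exact: measurable_fun_mul_prod.
have -> : (fun x => \int[P]_y `|(EFin \o (fun z : T1 * T2 => (f z.1 * g z.2)%R))
    (x, y)|)%E = (fun x => (`|f x| * \int[P]_y `|g y|)%:E).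
  apply/funext => x /=.
  under eq_integral do rewrite normrM.
  have ngi : P.-integrable setT (EFin \o (fun y => `|g y|)).
    exact: (integrable_abse gi).
  rewrite -RintegralZl// EFin_Rintegral//.
  rewrite (_ : _ \o _ = (fun y => `|f x|%:E * (EFin \o (fun y => `|g y|%R)) y)%E)//.
  exact: integrableZl.
have nfi : Q.-integrable setT (EFin \o (fun x => `|f x| * \int[P]_y `|g y|)).
  rewrite (_ : _ \o _ = ((EFin \o (fun x => `|f x|%R)) \*
    cst (\int[P]_y `|g y|)%:E)%E)//.
  by apply: integrableZr => //; exact: (integrable_abse fi).
by rewrite EFin_Rintegral// ltry.
Qed.

Lemma Rintegral_prod_mul (f : T1 -> R) (g : T2 -> R) :
  Q.-integrable setT (EFin \o f) -> P.-integrable setT (EFin \o g) ->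
  \int[(Q \x P)%E]_z (f z.1 * g z.2) = (\int[Q]_x f x) * (\int[P]_y g y).
Proof.
move=> fi gi.
rewrite [LHS]/Rintegral -(integral12_prod_meas1 (integrable_prod_mul f g fi gi)).
have -> : (fun x => fubini_F P (EFin \o (fun z : T1 * T2 => f z.1 * g z.2)) x)
    = (fun x => (f x * \int[P]_y g y)%:E).
  apply/funext => x; rewrite /fubini_F /= -RintegralZl// EFin_Rintegral//.
  rewrite (_ : _ \o _ = (fun y => (f x)%:E * (EFin \o g) y)%E)//.
  exact: integrableZl.
by rewrite -RintegralZr.
Qed.

(** Turns a pointwise approximation by sums of products into one of the integral by products of
    marginal integrals. The remainder [r] depends on the second coordinate alone, so the error
    involves only [P]. *)
Lemma Rintegral_prod_approx (n : nat) (G : T1 * T2 -> R) (f : nat -> T1 -> R)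
    (g : nat -> T2 -> R) (r : T2 -> R) (B e : R) :
  measurable_fun setT G -> (forall z, `|G z| <= B) ->
  (forall k, measurable_fun setT (f k)) -> (forall k x, `|f k x| <= B) ->
  (forall k, measurable_fun setT (g k)) -> (forall k x, `|g k x| <= 1) ->
  measurable_fun setT r -> (forall x, `|r x| <= 1) ->
  (forall z, `|G z - \sum_(k < n) f k z.1 * g k z.2| <= e + B * r z.2) ->
  `|\int[(Q \x P)%E]_z G z -
    \sum_(k < n) (\int[Q]_x f k x) * (\int[P]_y g k y)|
  <= e + B * \int[P]_y r y.
Proof.
move=> mG GB mf fB mg gB mr rB Gfg.
have Gi := bounded_integrable _ _ _ (Q \x P)%E G B mG GB.
have fi k := bounded_integrable _ _ _ Q (f k) B (mf k) (fB k).
have gi k := bounded_integrable _ _ _ P (g k) 1 (mg k) (gB k).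
have hi k : (Q \x P)%E.-integrable setT
    (EFin \o (fun z : T1 * T2 => f k z.1 * g k z.2)).
  exact: integrable_prod_mul.
have mh : measurable_fun setT
    (fun z : T1 * T2 => \sum_(k < n) f k z.1 * g k z.2).
  by apply: measurable_sum => k; exact: measurable_fun_mul_prod.
have hsi : (Q \x P)%E.-integrable setT
    (EFin \o (fun z : T1 * T2 => \sum_(k < n) f k z.1 * g k z.2)).
  apply: (bounded_integrable _ _ _ (Q \x P)%E _ (\sum_(k < n) B * 1)) => //.
  move=> x; apply: le_trans (ler_norm_sum _ _ _) _; apply: ler_sum => k _.
  by rewrite normrM ler_pM.
have mr2 : measurable_fun setT (fun z : T1 * T2 => r z.2).
  exact: (measurableT_comp mr measurable_snd).
have ri := bounded_integrable _ _ _ (Q \x P)%E _ 1 mr2 (fun z => rB z.2).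
have -> : \sum_(k < n) (\int[Q]_x f k x) * (\int[P]_y g k y) =
    \int[(Q \x P)%E]_z (\sum_(k < n) f k z.1 * g k z.2).
  rewrite (Rintegral_sum _ _ _ (Q \x P)%E n
    (fun k (z : T1 * T2) => f k z.1 * g k z.2))//.
  by apply: eq_bigr => k _; rewrite Rintegral_prod_mul.
have -> : \int[P]_y r y = \int[(Q \x P)%E]_z r z.2.
  transitivity (\int[(Q \x P)%E]_z (1 * r z.2)).
    rewrite (Rintegral_prod_mul (fun=> 1) r).
    - by rewrite Rintegral_cst// [X in fine X](probability_setT Q) !mul1r.
    - by apply: (bounded_integrable _ _ _ Q (fun=> 1) 1) => // x; rewrite normr1.
    - exact: (bounded_integrable _ _ _ P r 1).
  by apply: eq_Rintegral => z _; rewrite mul1r.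
rewrite -RintegralB//.
have mD : measurable_fun setT
    (fun z : T1 * T2 => G z - \sum_(k < n) f k z.1 * g k z.2).
  exact: measurable_funB.
have Di : (Q \x P)%E.-integrable setT
    (EFin \o (fun z : T1 * T2 => G z - \sum_(k < n) f k z.1 * g k z.2)).
  rewrite (_ : _ \o _ = (EFin \o G) \- (EFin \o
    (fun z : T1 * T2 => (\sum_(k < n) f k z.1 * g k z.2)%R)))%E//.
  exact: integrableB.
have Bri : (Q \x P)%E.-integrable setT
    (EFin \o (fun z : T1 * T2 => B * r z.2)).
  rewrite (_ : _ \o _ = (fun z => B%:E * (EFin \o (fun z => r z.2)) z)%E)//.
  exact: integrableZl.
have ci : (Q \x P)%E.-integrable setT (EFin \o (fun _ : T1 * T2 => e)).
  by apply: (bounded_integrable _ _ _ (Q \x P)%E (fun=> e) `|e|).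
apply: le_trans (le_normr_Rintegral measurableT Di) _.
have -> : e + B * \int[(Q \x P)%E]_z r z.2 =
    \int[(Q \x P)%E]_z (e + B * r z.2).
  rewrite RintegralD// RintegralZl// Rintegral_cst//.
  by rewrite [X in fine X](probability_setT (Q \x P)%E) mulr1.
apply: le_Rintegral => //; first exact: (integrable_abse Di).
rewrite (_ : _ \o _ = (EFin \o (fun=> e)) \+
  (EFin \o (fun z : T1 * T2 => (B * r z.2)%R)))%E//.
exact: integrableD.
Qed.

End product_integrals.

(** * Weak convergence of product laws *)

Section partition_of_unity.
Context (R : realType) (S : Type) (D : S -> S -> R) (s : nat -> S) (del : R).

Definition bump (k : nat) (x : S) : R :=
  Num.min 1 (Num.max 0 (2 - 2 * (D x (s k) / del))).

(** The functions [uncovered k * bump k] are the continuous analogue of making the cover by balls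
    disjoint; [uncovered n] is what the first [n] of them leave over. *)
Definition uncovered (n : nat) (x : S) : R := \prod_(k < n) (1 - bump k x).

Lemma bump_ge0 k x : 0 <= bump k x.
Proof. by rewrite /bump le_min ler01 le_max lexx. Qed.

Lemma bump_le1 k x : bump k x <= 1.
Proof. by rewrite /bump ge_min lexx. Qed.

Lemma bump_eq0 k x : 0 < del -> del <= D x (s k) -> bump k x = 0.
Proof.
move=> del0 Dd; rewrite /bump max_l ?min_r//.
by rewrite subr_le0 -[leLHS]mulr1 ler_pM2l// ler_pdivlMr// mul1r.
Qed.

Lemma bump_eq1 k x : 0 < del -> D x (s k) <= del / 2 -> bump k x = 1.
Proof.
move=> del0 Dd; have h : D x (s k) / del <= 2^-1.
  by rewrite ler_pdivrMr// mulrC.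
by rewrite /bump min_l// le_max; apply/orP; right; lra.
Qed.

Lemma uncovered_ge0 n x : 0 <= uncovered n x.
Proof. by apply: prodr_ge0 => k _; rewrite subr_ge0 bump_le1. Qed.

Lemma uncoveredS n x : uncovered n.+1 x = uncovered n x * (1 - bump n x).
Proof. by rewrite /uncovered big_ord_recr. Qed.

Lemma uncovered_le1 n x : uncovered n x <= 1.
Proof.
by apply: prodr_ile1 => k _; rewrite subr_ge0 bump_le1/= lerBlDr lerDl bump_ge0.
Qed.

(** The sum telescopes: [uncovered k * bump k] is [uncovered k - uncovered k.+1]. *)
Lemma sum_partition n x :
  \sum_(k < n) uncovered k x * bump k x + uncovered n x = 1.
Proof.
elim: n => [|n IH]; first by rewrite big_ord0 add0r /uncovered big_ord0.
by rewrite big_ord_recr /= uncoveredS -[RHS]IH; ring.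
Qed.

Lemma uncovered_eventually0 k n x : 0 < del -> D x (s k) <= del / 2 ->
  (k < n)%N -> uncovered n x = 0.
Proof.
move=> del0 Dd kn; rewrite /uncovered (bigD1 (Ordinal kn))//= bump_eq1//.
by rewrite subrr mul0r.
Qed.

(** The difference is an average of [f x - f (s k)] plus [f x] times the remainder. A term of
    positive weight has [D x (s k) < del], since [bump k] vanishes farther away. *)
Lemma partition_approx n (B e : R) (f : S -> R) x :
  0 < del -> 0 <= e ->
  (forall y, `|f y| <= B) ->
  (forall y, D x y < del -> `|f x - f y| <= e) ->
  `|f x - \sum_(k < n) f (s k) * (uncovered k x * bump k x)|
  <= e + B * uncovered n x.
Proof.
move=> del0 e0 fB fe.
have -> : f x - \sum_(k < n) f (s k) * (uncovered k x * bump k x) =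
    \sum_(k < n) (f x - f (s k)) * (uncovered k x * bump k x)
    + f x * uncovered n x.
  under [in RHS]eq_bigr do rewrite mulrBl.
  rewrite big_split/= sumrN -mulr_sumr.
  have -> : \sum_(k < n) uncovered k x * bump k x = 1 - uncovered n x.
    by rewrite -(sum_partition n x) addrK.
  by ring.
apply: le_trans (ler_normD _ _) _; apply: lerD; last first.
  by rewrite normrM (ger0_norm (uncovered_ge0 n x)) ler_wpM2r// uncovered_ge0.
apply: le_trans (ler_norm_sum _ _ _) _.
apply: (@le_trans _ _ (\sum_(k < n) e * (uncovered k x * bump k x))).
  apply: ler_sum => k _.
  have p0 : 0 <= uncovered k x * bump k x.
    by rewrite mulr_ge0 ?uncovered_ge0 ?bump_ge0.
  rewrite normrM (ger0_norm p0).
  have [Dk|Dk] := ltP (D x (s k)) del; first by rewrite ler_wpM2r// fe.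
  by rewrite bump_eq0// mulr0 !mulr0.
rewrite -mulr_sumr ler_piMr//.
by rewrite -(sum_partition n x) lerDl uncovered_ge0.
Qed.

End partition_of_unity.

Lemma continuous_bump (R : realType) (S : topologicalType) (D : S -> S -> R)
    (s : nat -> S) (del : R) (k : nat) :
  (forall t, continuous (D ^~ t)) -> continuous (bump R S D s del k).
Proof.
move=> cD x; apply: (@continuous_min R S (fun=> 1)); first exact: cvg_cst.
apply: (@continuous_max R S (fun=> 0)); first exact: cvg_cst.
apply: cvgB; first exact: cvg_cst.
apply: cvgM; first exact: cvg_cst.
by apply: cvgM; [exact: cD|exact: cvg_cst].
Qed.

Lemma continuous_uncovered (R : realType) (S : topologicalType)
    (D : S -> S -> R) (s : nat -> S) (del : R) (n : nat) :
  (forall t, continuous (D ^~ t)) -> continuous (uncovered R S D s del n).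
Proof.
move=> cD; elim: n => [|n IH] x.
  rewrite (_ : uncovered _ _ _ _ _ _ = fun=> 1); first exact: cvg_cst.
  by apply/funext => y; rewrite /uncovered big_ord0.
rewrite (_ : uncovered _ _ _ _ _ _ = uncovered R S D s del n \*
  (fun y => 1 - bump R S D s del n y)); last first.
  by apply/funext => y; rewrite uncoveredS.
apply: continuousM; first exact: IH.
by apply: cvgB; [exact: cvg_cst|exact: continuous_bump].
Qed.

Section measurable_partition.
Context (R : realType) (S : Type) (D : S -> S -> R) (s : nat -> S) (del : R).
Context (d : measure_display) (Omega : measurableType d) (Z : Omega -> S).
Hypothesis mZ : forall t, measurable_fun setT (fun w => D (Z w) t).

Lemma measurable_bump k :
  measurable_fun setT (fun w => bump R S D s del k (Z w)).
Proof.
apply: measurable_minr; first exact: measurable_cst.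
apply: measurable_maxr; first exact: measurable_cst.
apply: measurable_funB; first exact: measurable_cst.
apply: measurable_funM; first exact: measurable_cst.
by apply: measurable_funM => //; exact: measurable_cst.
Qed.

Lemma measurable_uncovered n :
  measurable_fun setT (fun w => uncovered R S D s del n (Z w)).
Proof.
apply: measurable_prod => k _; apply: measurable_funB; first exact: measurable_cst.
exact: measurable_bump.
Qed.

(** Every point is within [del / 2] of some [s k], so [uncovered n] vanishes there for all [n > k];
    dominated convergence concludes. *)
Lemma uncovered_Rintegral_cvg0 (P : probability Omega R) :
  0 < del -> (forall x e, 0 < e -> exists k, D x (s k) < e) ->
  (fun n => \int[P]_w uncovered R S D s del n (Z w)) @ \oo --> (0 : R).
Proof.
move=> del0 sd.
have norm_le1 n w : `|uncovered R S D s del n (Z w)| <= 1.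
  by rewrite ger0_norm ?uncovered_ge0 ?uncovered_le1.
have [|||||_ _] := @dominated_convergence _ Omega R P setT measurableT
  (fun n w => (uncovered R S D s del n (Z w))%:E) (cst 0%E) (cst 1%E).
- by move=> n; apply/measurable_EFinP; exact: measurable_uncovered.
- exact: measurable_cst.
- apply: aeW => w _; apply: cvg_near_cst.
  have [k Dk] := sd (Z w) _ (divr_gt0 del0 (@ltr0n R 2)).
  exists k.+1 => // n kn.
  by rewrite (uncovered_eventually0 _ _ _ _ _ k)// ltW.
- exact: finite_measure_integrable_cst.
- by apply: aeW => w n _; rewrite lee_fin.
rewrite integral0 => /fine_cvg; exact.
Qed.

End measurable_partition.

Lemma cvg_sum_ord (R : realType) (n : nat) (u : nat -> nat -> R) (l : nat -> R) :
  (forall k, u k @ \oo --> l k) ->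
  (fun m => \sum_(k < n) u k m) @ \oo --> \sum_(k < n) l k.
Proof.
move=> ul; elim: n => [|n IH].
  by under eq_fun do rewrite big_ord0; rewrite big_ord0; exact: cvg_cst.
under eq_fun do rewrite big_ord_recr; rewrite big_ord_recr /=.
exact: cvgD.
Qed.

(** The function [F t x] is replaced by the sum of [F t (s k)] times the [k]-th partition function
    at [x], uniformly in [t]. Hence [W] enters only through the integrals of [F (W _) x] at fixed
    [x], and [T] carries no topology; this allows [W] to bundle several copies already treated. *)
Lemma cvg_prod_Rintegral (R : realType) (S : topologicalType) (T : Type)
    (D : S -> S -> R) (s : nat -> S)
    (d1 d2 : measure_display) (Om1 : measurableType d1)
    (Om2 : measurableType d2) (Q : probability Om1 R) (P : probability Om2 R)
    (W : Om1 -> T) (Z : Om2 -> S)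
    (d1_ d2_ : nat -> measure_display)
    (Om1_ : forall n, measurableType (d1_ n))
    (Om2_ : forall n, measurableType (d2_ n))
    (Q_ : forall n, probability (Om1_ n) R)
    (P_ : forall n, probability (Om2_ n) R)
    (W_ : forall n, Om1_ n -> T) (Z_ : forall n, Om2_ n -> S)
    (F : T -> S -> R) (B : R) :
  (forall t, continuous (D ^~ t)) ->
  (forall x e, 0 < e -> exists k, D x (s k) < e) ->
  (forall t, measurable_fun setT (fun w => D (Z w) t)) ->
  (forall n t, measurable_fun setT (fun w => D (Z_ n w) t)) ->
  (forall f : S -> R, continuous f -> (forall x, `|f x| <= 1) ->
    measurable_fun setT (fun w => f (Z w)) ->
    (forall n, measurable_fun setT (fun w => f (Z_ n w))) ->
    (fun n => \int[P_ n]_w f (Z_ n w)) @ \oo --> \int[P]_w f (Z w)) ->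
  (forall t x, `|F t x| <= B) ->
  (forall e, 0 < e -> exists2 del, 0 < del & forall x y, D x y < del ->
    forall t, `|F t x - F t y| <= e) ->
  measurable_fun setT (fun z : Om1 * Om2 => F (W z.1) (Z z.2)) ->
  (forall n, measurable_fun setT
    (fun z : Om1_ n * Om2_ n => F (W_ n z.1) (Z_ n z.2))) ->
  (forall x, measurable_fun setT (fun w => F (W w) x)) ->
  (forall n x, measurable_fun setT (fun w => F (W_ n w) x)) ->
  (forall x, (fun n => \int[Q_ n]_w F (W_ n w) x) @ \oo -->
    \int[Q]_w F (W w) x) ->
  (fun n => \int[(Q_ n \x P_ n)%E]_z F (W_ n z.1) (Z_ n z.2)) @ \oo -->
    \int[(Q \x P)%E]_z F (W z.1) (Z z.2).
Proof.
move=> cD sd mZ mZ_ cvgZ FB Fuc mF mF_ mFx mFx_ cvgF.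
have B0 : 0 <= B.
  exact: le_trans (FB (W point) (Z point)).
apply/cvgrPdist_le => e e0.
(* The six parts: two for the limit law (oscillation and uncovered mass), one for the finite sums,
   and three for the [n]-th law (oscillation, uncovered mass of the limit, and the change of that
   mass). *)
have e6 : 0 < e / 6 by rewrite divr_gt0.
have [del del0 Fdel] := Fuc _ e6.
pose g k x := uncovered R S D s del k x * bump R S D s del k x.
have g_le1 k x : `|g k x| <= 1.
  rewrite /g normrM !ger0_norm ?uncovered_ge0 ?bump_ge0//.
  by rewrite mulr_ile1 ?uncovered_ge0 ?bump_ge0 ?uncovered_le1 ?bump_le1.
have r_le1 n x : `|uncovered R S D s del n x| <= 1.
  by rewrite ger0_norm ?uncovered_ge0 ?uncovered_le1.
have cg k : continuous (g k).
  move=> x; apply: cvgM; first exact: continuous_uncovered.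
  exact: continuous_bump.
have mg k : measurable_fun setT (fun w => g k (Z w)).
  by apply: measurable_funM; [exact: measurable_uncovered|exact: measurable_bump].
have mg_ n k : measurable_fun setT (fun w => g k (Z_ n w)).
  by apply: measurable_funM; [exact: measurable_uncovered|exact: measurable_bump].
have approx N (w : T) x :
    `|F w x - \sum_(k < N) F w (s k) * g k x|
    <= e / 6 + B * uncovered R S D s del N x.
  by apply: partition_approx => //; [exact: ltW|move=> y xy; exact: Fdel].
have lim0 : (fun N => B * \int[P]_w uncovered R S D s del N (Z w)) @ \oo -->
    (0 : R).
  rewrite -(mulr0 B); apply: cvgM; first exact: cvg_cst.
  exact: uncovered_Rintegral_cvg0.
have [N _ /(_ N (leqnn N)) /=] := cvgr_dist_le _ _ lim0 _ e6.
rewrite sub0r normrN => BN.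
pose b := \sum_(k < N) (\int[Q]_w F (W w) (s k)) * (\int[P]_w g k (Z w)).
pose b_ n := \sum_(k < N) (\int[Q_ n]_w F (W_ n w) (s k)) *
  (\int[P_ n]_w g k (Z_ n w)).
have cvgb : b_ @ \oo --> b.
  apply: (cvg_sum_ord _ N (fun k n => (\int[Q_ n]_w F (W_ n w) (s k)) *
    (\int[P_ n]_w g k (Z_ n w))) (fun k => (\int[Q]_w F (W w) (s k)) *
    (\int[P]_w g k (Z w)))) => k; apply: cvgM; first exact: cvgF.
  by apply: cvgZ => // n; exact: mg_.
have ab : `|\int[(Q \x P)%E]_z F (W z.1) (Z z.2) - b| <=
    e / 6 + B * \int[P]_w uncovered R S D s del N (Z w).
  apply: (Rintegral_prod_approx _ _ _ _ _ Q P N _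
    (fun k w => F (W w) (s k)) (fun k w => g k (Z w))) => //.
  exact: measurable_uncovered.
have ab_ n : `|\int[(Q_ n \x P_ n)%E]_z F (W_ n z.1) (Z_ n z.2) - b_ n| <=
    e / 6 + B * \int[P_ n]_w uncovered R S D s del N (Z_ n w).
  apply: (Rintegral_prod_approx _ _ _ _ _ (Q_ n) (P_ n) N _
    (fun k w => F (W_ n w) (s k)) (fun k w => g k (Z_ n w))) => //.
  exact: measurable_uncovered.
(* The index [N] was chosen from the limit law alone; as [uncovered] is bounded and continuous, weak
   convergence carries the smallness over to the [n]-th law. *)
have cvgr : (fun n => B * \int[P_ n]_w uncovered R S D s del N (Z_ n w)) @ \oo
    --> B * \int[P]_w uncovered R S D s del N (Z w).
  apply: cvgM; first exact: cvg_cst.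
  apply: cvgZ => //; first exact: continuous_uncovered.
    exact: measurable_uncovered.
  by move=> n; exact: measurable_uncovered.
near=> n.
have h1 : `|b - b_ n| <= e / 6 by near: n; exact: (cvgr_dist_le _ _ cvgb).
have h2 : `|B * \int[P]_w uncovered R S D s del N (Z w) -
    B * \int[P_ n]_w uncovered R S D s del N (Z_ n w)| <= e / 6.
  by near: n; exact: (cvgr_dist_le _ _ cvgr).
have h3 := ab_ n.
move: h1 h2 h3 ab BN; rewrite !ler_norml.
set u := \int[_]_z _; set v := \int[_]_z _.
set p := B * _; set q := B * _ => /andP[? ?] /andP[? ?] /andP[? ?] /andP[? ?].
move=> /andP[? ?]; apply/andP; split; lra.
Unshelve. all: by end_near.
Qed.

(** * The four-cycle kernel *)

(** Covers the identity and the truncations [min _ M] together, so that one bound with one constant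
    serves the kernel and its truncations. *)
Definition lipschitz_cut (R : realType) (c : R -> R) : Prop :=
  (forall p : R, 0 <= p -> 0 <= c p <= p) /\
  (forall p q : R, 0 <= p -> 0 <= q -> `|c p - c q| <= `|p - q|).

Lemma lipschitz_cut_id (R : realType) : lipschitz_cut R id.
Proof. by split=> [p -> //=|p q _ _]. Qed.

Lemma lipschitz_cut_min (R : realType) (M : R) : 0 <= M ->
  lipschitz_cut R (Num.min ^~ M).
Proof.
move=> M0; split=> [p p0|p q _ _]; first by rewrite le_min p0 M0 ge_min lexx.
rewrite /Num.min; case: ltP => pM; case: ltP => qM //.
- by rewrite !ler0_norm; lra.
- by rewrite !ger0_norm; lra.
- by rewrite subrr normr0.
Qed.

Definition cut_hat (R : realType) (T : metricType R) (c : R -> R) (al : R)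
    (x1 x2 x3 x4 : T) : R :=
  c (mdist x1 x2) `^ al - c (mdist x2 x3) `^ al
  + c (mdist x3 x4) `^ al - c (mdist x4 x1) `^ al.

Lemma mdist_dist (R : realType) (T : metricType R) (x y z : T) :
  `|mdist x y - mdist z y| <= mdist x z.
Proof.
rewrite ler_norml lerNl opprB lerBlDr lerBlDr metric_triangle andbT.
by rewrite (metric_sym x z) metric_triangle.
Qed.

(* The four-cycle of distances splits into two differences either through
   [x1], [x3] or through [x2], [x4]; pairing along the smaller of the two
   scales [u], [v] gains the factor [min u v] over the trivial bound. *)
Lemma cut_hat_bound (R : realType) (al e : R) : 0 < al ->
  al <= 2 * e -> al - 1 <= e ->
  exists2 C, 0 <= C & forall (c : R -> R) (T : metricType R) (o : T)
    (x1 x2 x3 x4 : T), lipschitz_cut R c ->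
  `|cut_hat R T c al x1 x2 x3 x4| <=
    C * (Num.max 1 (mdist x1 o) `^ e * Num.max 1 (mdist x2 o) `^ e *
         Num.max 1 (mdist x3 o) `^ e * Num.max 1 (mdist x4 o) `^ e).
Proof.
move=> al0 ale ale1; have e0 : 0 <= e by lra.
have [C C0 key] := powR_dist_bound R al e al0 ale ale1.
exists (2 * C) => [|c T o x1 x2 x3 x4 [c_le c_lip]]; first by rewrite mulr_ge0.
pose n x := Num.max 1 (mdist x o).
have n1 x : 1 <= n x by rewrite /n le_max lexx.
have nd x : mdist x o <= n x by rewrite /n le_max lexx orbT.
have n0 x : 0 <= n x by apply: le_trans (n1 x).
pose u := Num.max (n x1) (n x3); pose v := Num.max (n x2) (n x4).
have [n1u n3u] : n x1 <= u /\ n x3 <= u by split; rewrite /u le_max lexx ?orbT.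
have [n2v n4v] : n x2 <= v /\ n x4 <= v by split; rewrite /v le_max lexx ?orbT.
have u1 : 1 <= u := le_trans (n1 x1) n1u.
have v1 : 1 <= v := le_trans (n1 x2) n2v.
have max_le_mul (a b : R) : 1 <= a -> 1 <= b -> Num.max a b <= a * b.
  move=> a1 b1; rewrite ge_max; apply/andP; split.
    by rewrite ler_peMr// (le_trans _ a1).
  by rewrite ler_peMl// (le_trans _ b1).
(* Norms are cut below at [1] so that the maximum of two of them is at most their product. *)
have uvE : (u * v) `^ e <= n x1 `^ e * n x2 `^ e * n x3 `^ e * n x4 `^ e.
  have -> : n x1 `^ e * n x2 `^ e * n x3 `^ e * n x4 `^ e =
      ((n x1 * n x3) * (n x2 * n x4)) `^ e.
    by rewrite !powRM ?mulr_ge0//; ring.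
  apply: ge0_ler_powR => //; rewrite ?nnegrE ?mulr_ge0//.
  - exact: le_trans u1.
  - exact: le_trans v1.
  - by apply: ler_pM; rewrite ?max_le_mul// (le_trans ler01).
have dist_le x y : mdist x y <= n x + n y.
  apply: le_trans (metric_triangle _ o _) _.
  by rewrite (metric_sym o) lerD.
have c_ge0 (x y : T) : 0 <= c (mdist x y).
  by have /andP[] := c_le _ (mdist_ge0 x y).
have c_led x y : c (mdist x y) <= n x + n y.
  by have /andP[_ /le_trans] := c_le _ (mdist_ge0 x y); apply.
have c_diff x y z : `|c (mdist x y) - c (mdist y z)| <= n x + n z.
  apply: le_trans (c_lip _ _ (mdist_ge0 _ _) (mdist_ge0 _ _)) _.
  by rewrite (metric_sym y z) (le_trans (mdist_dist _ _ _ _ _)).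
have c_diff' x y z : `|c (mdist y x) - c (mdist z y)| <= n x + n z.
  by rewrite (metric_sym y x) (metric_sym z y) c_diff.
apply: (@le_trans _ _ (2 * C * (u * v) `^ e)); last first.
  by rewrite ler_wpM2l// mulr_ge0.
have d12 := c_led x1 x2; have d23 := c_led x2 x3.
have d34 := c_led x3 x4; have d41 := c_led x4 x1.
(* If [u <= v], edges are paired at their common vertex [x2] or [x4]: the two lengths differ by at
   most [n x1 + n x3 <= 2 * u]. Otherwise they are paired at [x1] and [x3]. *)
rewrite /cut_hat; have [uv|/ltW vu] := leP u v.
  have h1 := key u v _ _ u1 uv (c_ge0 x1 x2) (c_ge0 x2 x3).
  have h2 := key u v _ _ u1 uv (c_ge0 x3 x4) (c_ge0 x4 x1).
  have {}h1 : `|c (mdist x1 x2) `^ al - c (mdist x2 x3) `^ al|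
      <= C * (u * v) `^ e.
    by apply: h1; [lra..|apply: le_trans (c_diff _ _ _) _; lra].
  have {}h2 : `|c (mdist x3 x4) `^ al - c (mdist x4 x1) `^ al|
      <= C * (u * v) `^ e.
    by apply: h2; [lra..|apply: le_trans (c_diff _ _ _) _; lra].
  rewrite -[X in `|X|]addrA; apply: le_trans (ler_normD _ _) _.
  by rewrite -mulrA mulr_natl mulr2n lerD.
have h1 := key v u _ _ v1 vu (c_ge0 x1 x2) (c_ge0 x4 x1).
have h2 := key v u _ _ v1 vu (c_ge0 x3 x4) (c_ge0 x2 x3).
have {}h1 : `|c (mdist x1 x2) `^ al - c (mdist x4 x1) `^ al|
    <= C * (v * u) `^ e.
  by apply: h1; [lra..|apply: le_trans (c_diff' _ _ _) _; lra].
have {}h2 : `|c (mdist x3 x4) `^ al - c (mdist x2 x3) `^ al|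
    <= C * (v * u) `^ e.
  by apply: h2; [lra..|apply: le_trans (c_diff' _ _ _) _; lra].
set a := _ `^ _; set b := _ `^ al; set a' := _ `^ al; set b' := _ `^ al.
have -> : a - b + a' - b' = (a - b') + (a' - b) by ring.
apply: le_trans (ler_normD _ _) _.
by rewrite -mulrA mulr_natl mulr2n (mulrC u) lerD.
Qed.

(** * The product kernel: domination and uniform continuity *)

Section cut_kernel.
Context (R : realType) (TX TY : metricType R) (al : R).

Definition cut_kernel (c : R -> R) (s1 s2 s3 s4 : TX * TY) : R :=
  cut_hat R TX c al s1.1 s2.1 s3.1 s4.1 * cut_hat R TY c al s1.2 s2.2 s3.2 s4.2.

Definition pair_dist (s t : TX * TY) : R := mdist s.1 t.1 + mdist s.2 t.2.

(** The constant [2] collects one unit for each of the two norms cut below at [1]. *)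
Definition moment_weight (xo : TX) (yo : TY) (p : R) (s : TX * TY) : R :=
  2 + mdist s.1 xo `^ p + mdist s.2 yo `^ p.

Lemma powR_max1_sqr (x e : R) : 0 <= x -> 0 <= e ->
  Num.max 1 x `^ e * Num.max 1 x `^ e <= 1 + x `^ (2 * e).
Proof.
move=> x0 e0.
rewrite -powRD; last by apply/implyP => _; rewrite gt_eqF// lt_max ltr01.
rewrite -mulr2n -[e *+ 2]mulr_natl /Num.max; case: ltP => x1.
  by rewrite lerDr.
by rewrite powR1 lerDl powR_ge0.
Qed.

(** The bounds on the two factors multiply to a product over the four pairs of [|x|^e |y|^e], and
    [2ab <= a^2 + b^2] bounds each of these by the weight. *)
Lemma cut_kernel_bound (xo : TX) (yo : TY) : 0 < al ->
  exists2 K, 0 <= K & forall c s1 s2 s3 s4, lipschitz_cut R c ->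
  `|cut_kernel c s1 s2 s3 s4| <=
    K * (moment_weight xo yo (alpha_star al) s1 *
         moment_weight xo yo (alpha_star al) s2 *
         moment_weight xo yo (alpha_star al) s3 *
         moment_weight xo yo (alpha_star al) s4).
Proof.
move=> al0; pose e := alpha_star al / 2.
have asE : alpha_star al = 2 * e by rewrite /e mulrCA divff ?mulr1.
have [asl asr] : al <= alpha_star al /\ 2 * al - 2 <= alpha_star al.
  by split; rewrite /alpha_star le_max lexx ?orbT.
have [||C C0 hb] := cut_hat_bound R al e al0; [lra..|].
have e0 : 0 <= e by lra.
exists (C * C) => [|c s1 s2 s3 s4 cc]; first by rewrite mulr_ge0.
rewrite /cut_kernel normrM.
apply: le_trans (ler_pM (normr_ge0 _) (normr_ge0 _)
  (hb c TX xo _ _ _ _ cc) (hb c TY yo _ _ _ _ cc)) _.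
pose g (s : TX * TY) := Num.max 1 (mdist s.1 xo) `^ e *
  Num.max 1 (mdist s.2 yo) `^ e.
have g0 s : 0 <= g s by rewrite mulr_ge0 ?powR_ge0.
have gw s : g s <= moment_weight xo yo (alpha_star al) s.
  rewrite /g /moment_weight asE.
  have h1 := powR_max1_sqr _ _ (mdist_ge0 s.1 xo) e0.
  have h2 := powR_max1_sqr _ _ (mdist_ge0 s.2 yo) e0.
  move: h1 h2; set a := _ `^ e; set b := _ `^ e => h1 h2.
  have a0 : 0 <= a := powR_ge0 _ _.
  have b0 : 0 <= b := powR_ge0 _ _.
  by have := sqr_ge0 (a - b); rewrite expr2; nra.
apply: (@le_trans _ _ (C * C * (g s1 * g s2 * g s3 * g s4))).
  by rewrite le_eqVlt; apply/orP; left; apply/eqP; rewrite /g; ring.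
clearbody g; rewrite ler_wpM2l ?mulr_ge0//.
by do 3![apply: ler_pM; rewrite ?mulr_ge0//].
Qed.

Lemma pair_distxx s : pair_dist s s = 0.
Proof. by rewrite /pair_dist !mdistxx addr0. Qed.

Lemma cut_hat_unif_cont (T : metricType R) (M e : R) :
  0 < al -> 0 <= M -> 0 < e ->
  exists2 del, 0 < del & forall x1 x2 x3 x4 y1 y2 y3 y4 : T,
  mdist x1 y1 < del -> mdist x2 y2 < del -> mdist x3 y3 < del ->
  mdist x4 y4 < del ->
  `|cut_hat R T (Num.min ^~ M) al x1 x2 x3 x4 -
    cut_hat R T (Num.min ^~ M) al y1 y2 y3 y4| <= e.
Proof.
(* One quarter for each of the four terms; below, [del / 2] appears because a distance changes by at
   most the sum of the displacements of its two ends. *)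
move=> al0 M0 e0; have e4 : 0 < e / 4 by rewrite divr_gt0.
have [del del0 key] := powR_unif_cont R al M _ al0 M0 e4.
have d2 : 0 < del / 2 by rewrite divr_gt0.
exists (del / 2) => // x1 x2 x3 x4 y1 y2 y3 y4 h1 h2 h3 h4.
have [c_le c_lip] := lipschitz_cut_min R M M0.
have k (x y x' y' : T) : mdist x x' < del / 2 -> mdist y y' < del / 2 ->
    `|Num.min (mdist x y) M `^ al - Num.min (mdist x' y') M `^ al| <= e / 4.
  move=> xx yy; apply: key.
  - by have /andP[] := c_le _ (mdist_ge0 x y).
  - by have /andP[] := c_le _ (mdist_ge0 x' y').
  - by rewrite ge_min lexx orbT.
  - by rewrite ge_min lexx orbT.
  apply: le_lt_trans (c_lip _ _ (mdist_ge0 _ _) (mdist_ge0 _ _)) _.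
  have := mdist_dist _ _ x y x'; have := mdist_dist _ _ y x' y'.
  rewrite (metric_sym y x') (metric_sym y' x') !ler_norml ltr_norml.
  by move=> /andP[? ?] /andP[? ?]; apply/andP; split; lra.
have := k _ _ _ _ h1 h2; have := k _ _ _ _ h2 h3.
have := k _ _ _ _ h3 h4; have := k _ _ _ _ h4 h1.
rewrite /cut_hat !ler_norml.
move=> /andP[? ?] /andP[? ?] /andP[? ?] /andP[? ?].
by apply/andP; split; lra.
Qed.

Lemma cut_hat_min_bound (T : metricType R) (M : R) (x1 x2 x3 x4 : T) :
  0 < al -> 0 <= M ->
  `|cut_hat R T (Num.min ^~ M) al x1 x2 x3 x4| <= 2 * M `^ al.
Proof.
move=> al0 M0.
have [c_le _] := lipschitz_cut_min R M M0.
have k (x y : T) : 0 <= Num.min (mdist x y) M `^ al <= M `^ al.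
  rewrite powR_ge0 ge0_ler_powR ?nnegrE ?ge_min ?lexx ?orbT//; first exact: ltW.
  by have /andP[] := c_le _ (mdist_ge0 x y).
have := k x1 x2; have := k x2 x3; have := k x3 x4; have := k x4 x1.
rewrite /cut_hat ler_norml.
move=> /andP[? ?] /andP[? ?] /andP[? ?] /andP[? ?].
by apply/andP; split; lra.
Qed.

Lemma cut_kernel_min_bound (M : R) s1 s2 s3 s4 : 0 < al -> 0 <= M ->
  `|cut_kernel (Num.min ^~ M) s1 s2 s3 s4| <= 2 * M `^ al * (2 * M `^ al).
Proof.
by move=> al0 M0; rewrite /cut_kernel normrM ler_pM ?cut_hat_min_bound.
Qed.

Lemma cut_kernel_unif_cont (M e : R) : 0 < al -> 0 <= M -> 0 < e ->
  exists2 del, 0 < del & forall s1 s2 s3 s4 t1 t2 t3 t4,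
  pair_dist s1 t1 < del -> pair_dist s2 t2 < del -> pair_dist s3 t3 < del ->
  pair_dist s4 t4 < del ->
  `|cut_kernel (Num.min ^~ M) s1 s2 s3 s4 -
    cut_kernel (Num.min ^~ M) t1 t2 t3 t4| <= e.
Proof.
move=> al0 M0 e0; pose B := 2 * M `^ al.
have B0 : 0 <= B by rewrite mulr_ge0 ?powR_ge0.
(* Each factor is bounded by [B], so the product changes by at most [2 * B * e']; the [+ 1] avoids
   division by zero. *)
pose e' := e / (2 * B + 1).
have e'0 : 0 < e' by rewrite divr_gt0// ltr_wpDl// mulr_ge0.
have [dx dx0 kx] := cut_hat_unif_cont TX M e' al0 M0 e'0.
have [dy dy0 ky] := cut_hat_unif_cont TY M e' al0 M0 e'0.
exists (Num.min dx dy) => [|s1 s2 s3 s4 t1 t2 t3 t4 h1 h2 h3 h4].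
  by rewrite lt_min dx0.
have lt_dist s t : pair_dist s t < Num.min dx dy ->
    mdist s.1 t.1 < dx /\ mdist s.2 t.2 < dy.
  rewrite lt_min /pair_dist => /andP[a b].
  by have := mdist_ge0 s.1 t.1; have := mdist_ge0 s.2 t.2; split; lra.
have [a1 b1] := lt_dist _ _ h1; have [a2 b2] := lt_dist _ _ h2.
have [a3 b3] := lt_dist _ _ h3; have [a4 b4] := lt_dist _ _ h4.
have hx := kx _ _ _ _ _ _ _ _ a1 a2 a3 a4.
have hy := ky _ _ _ _ _ _ _ _ b1 b2 b3 b4.
have bx := cut_hat_min_bound TX M t1.1 t2.1 t3.1 t4.1 al0 M0.
have bY := cut_hat_min_bound TY M s1.2 s2.2 s3.2 s4.2 al0 M0.
rewrite /cut_kernel; move: hx hy bx bY.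
set f := cut_hat _ _ _ _ _ _ _ _; set f' := cut_hat _ _ _ _ _ _ _ _.
set g := cut_hat _ _ _ _ _ _ _ _; set g' := cut_hat _ _ _ _ _ _ _ _.
rewrite -/B => hx hy bx bY.
have -> : f * g - f' * g' = (f - f') * g + f' * (g - g') by ring.
apply: le_trans (ler_normD _ _) _; rewrite !normrM.
apply: (@le_trans _ _ (e' * B + B * e')).
  by apply: lerD; apply: ler_pM.
have <- : e' * (2 * B + 1) = e.
  by rewrite /e' divfK// gt_eqF// ltr_wpDl// mulr_ge0.
by nra.
Qed.

Lemma cut_kernel_min_eq (M : R) s1 s2 s3 s4 :
  mdist s1.1 s2.1 <= M -> mdist s2.1 s3.1 <= M -> mdist s3.1 s4.1 <= M ->
  mdist s4.1 s1.1 <= M ->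
  mdist s1.2 s2.2 <= M -> mdist s2.2 s3.2 <= M -> mdist s3.2 s4.2 <= M ->
  mdist s4.2 s1.2 <= M ->
  cut_kernel (Num.min ^~ M) s1 s2 s3 s4 = cut_kernel id s1 s2 s3 s4.
Proof. by move=> *; rewrite /cut_kernel /cut_hat !min_l. Qed.

End cut_kernel.

(** * Uniform integrability as small excess *)

Section fourfold_integrals.
Context (R : realType) (d : measure_display) (T : measurableType d).
Variable P : probability T R.

Lemma integrable_prod4 (f1 f2 f3 f4 : T -> R) :
  P.-integrable setT (EFin \o f1) -> P.-integrable setT (EFin \o f2) ->
  P.-integrable setT (EFin \o f3) -> P.-integrable setT (EFin \o f4) ->
  (P \x P \x P \x P)%E.-integrable setT (EFin \o
    (fun w : T * T * T * T => f1 w.1.1.1 * f2 w.1.1.2 * f3 w.1.2 * f4 w.2)).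
Proof.
move=> i1 i2 i3 i4.
have i12 := integrable_prod_mul _ _ _ _ _ P P f1 f2 i1 i2.
have i123 := integrable_prod_mul _ _ _ _ _ (P \x P)%E P _ f3 i12 i3.
exact: (integrable_prod_mul _ _ _ _ _ (P \x P \x P)%E P _ f4 i123 i4).
Qed.

Lemma Rintegral_prod4 (f1 f2 f3 f4 : T -> R) :
  P.-integrable setT (EFin \o f1) -> P.-integrable setT (EFin \o f2) ->
  P.-integrable setT (EFin \o f3) -> P.-integrable setT (EFin \o f4) ->
  \int[(P \x P \x P \x P)%E]_w (f1 w.1.1.1 * f2 w.1.1.2 * f3 w.1.2 * f4 w.2) =
  (\int[P]_x f1 x) * (\int[P]_x f2 x) * (\int[P]_x f3 x) * (\int[P]_x f4 x).
Proof.
move=> i1 i2 i3 i4.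
have i12 := integrable_prod_mul _ _ _ _ _ P P f1 f2 i1 i2.
have i123 := integrable_prod_mul _ _ _ _ _ (P \x P)%E P _ f3 i12 i3.
rewrite (Rintegral_prod_mul _ _ _ _ _ (P \x P \x P)%E P
  (fun w => f1 w.1.1 * f2 w.1.2 * f3 w.2) f4)//.
rewrite (Rintegral_prod_mul _ _ _ _ _ (P \x P)%E P
  (fun w => f1 w.1 * f2 w.2) f3)//.
by rewrite Rintegral_prod_mul.
Qed.

Lemma le_EFin_integrable (f g : T -> R) : measurable_fun setT f ->
  P.-integrable setT (EFin \o g) -> (forall x, `|f x| <= g x) ->
  P.-integrable setT (EFin \o f).
Proof.
move=> mf gi fg; apply: (le_integrable measurableT _ _ gi).
  exact/measurable_EFinP.
by move=> x _; rewrite /= lee_fin (le_trans (fg x))// ler_norm.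
Qed.

Lemma Rintegral_norm_le (f g : T -> R) : measurable_fun setT f ->
  P.-integrable setT (EFin \o g) -> (forall x, `|f x| <= g x) ->
  `|\int[P]_x f x| <= \int[P]_x g x.
Proof.
move=> mf gi fg; have fi := le_EFin_integrable f g mf gi fg.
apply: le_trans (le_normr_Rintegral measurableT fi) _.
by apply: le_Rintegral => //; exact: (integrable_abse fi).
Qed.

Lemma integrable_EFinD (f g : T -> R) : P.-integrable setT (EFin \o f) ->
  P.-integrable setT (EFin \o g) ->
  P.-integrable setT (EFin \o (fun x => f x + g x)).
Proof.
move=> fi gi.
by rewrite (_ : _ \o _ = ((EFin \o f) \+ (EFin \o g))%E)//; exact: integrableD.
Qed.

Lemma integrable_EFinZl (k : R) (f : T -> R) : P.-integrable setT (EFin \o f) ->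
  P.-integrable setT (EFin \o (fun x => k * f x)).
Proof.
move=> fi; rewrite (_ : _ \o _ = (fun x => k%:E * (EFin \o f) x)%E)//.
exact: integrableZl.
Qed.

End fourfold_integrals.

Section fourfold_tail.
Context (R : realType) (d : measure_display) (T : measurableType d).
Variable P : probability T R.

(** Independence factors each of the four summands into one integral of [r] and three of [h]. *)
Lemma Rintegral4_tail (h r : T -> R) (G : T * T * T * T -> R) (K : R) :
  P.-integrable setT (EFin \o h) -> P.-integrable setT (EFin \o r) ->
  measurable_fun setT G ->
  (forall w, `|G w| <= K *
    (r w.1.1.1 * h w.1.1.2 * h w.1.2 * h w.2 +
     h w.1.1.1 * r w.1.1.2 * h w.1.2 * h w.2 +
     h w.1.1.1 * h w.1.1.2 * r w.1.2 * h w.2 +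
     h w.1.1.1 * h w.1.1.2 * h w.1.2 * r w.2)) ->
  `|\int[(P \x P \x P \x P)%E]_w G w| <=
    4 * K * (\int[P]_x r x) * (\int[P]_x h x) ^+ 3.
Proof.
move=> hi ri mG Gle.
have i1 := integrable_prod4 _ _ _ P r h h h ri hi hi hi.
have i2 := integrable_prod4 _ _ _ P h r h h hi ri hi hi.
have i3 := integrable_prod4 _ _ _ P h h r h hi hi ri hi.
have i4 := integrable_prod4 _ _ _ P h h h r hi hi hi ri.
have i12 := integrable_EFinD _ _ _ _ _ _ i1 i2.
have i123 := integrable_EFinD _ _ _ _ _ _ i12 i3.
have i1234 := integrable_EFinD _ _ _ _ _ _ i123 i4.
have := Rintegral_norm_le _ _ _ (P \x P \x P \x P)%E _ _ mG
  (integrable_EFinZl _ _ _ _ K _ i1234) Gle.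
move/le_trans; apply; rewrite RintegralZl// !RintegralD//.
rewrite !Rintegral_prod4// le_eqVlt; apply/orP; left; apply/eqP.
by ring.
Qed.

End fourfold_tail.

(** * Caps and excesses of a nonnegative variable *)

Section tails.
Context (R : realType) (d : measure_display) (Omega : measurableType d).
Variables (P : probability Omega R) (U : Omega -> R).
Hypotheses (U0 : forall w, 0 <= U w) (mU : measurable_fun setT U).

Lemma measurable_cap (c : R) : measurable_fun setT (fun w => Num.min (U w) c).
Proof. by apply: measurable_minr => //; exact: measurable_cst. Qed.

Lemma measurable_excess (c : R) :
  measurable_fun setT (fun w => Num.max (U w - c) 0).
Proof.
apply: measurable_maxr; last exact: measurable_cst.
by apply: measurable_funB => //; exact: measurable_cst.
Qed.

Lemma excess_ge0 (c : R) w : 0 <= Num.max (U w - c) 0.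
Proof. by rewrite le_max lexx orbT. Qed.

Lemma cap_norm_le (c : R) w : 0 <= c -> `|Num.min (U w) c| <= c.
Proof. by move=> c0; rewrite ger0_norm ?le_min ?U0// ge_min lexx orbT. Qed.

Lemma integrable_cap (c : R) : 0 <= c ->
  P.-integrable setT (EFin \o (fun w => Num.min (U w) c)).
Proof.
move=> c0; apply: (bounded_integrable _ _ _ P _ c); first exact: measurable_cap.
by move=> w; exact: cap_norm_le.
Qed.

(** This split replaces the one by the indicator of [U > c]: the cap is bounded and continuous in
    [U], so its mean passes to weak limits, and the excess carries the integrability. *)
Lemma cap_excess (c : R) w : U w = Num.min (U w) c + Num.max (U w - c) 0.
Proof.
have [Uc|cU] := leP (U w) c.
  by rewrite max_r ?addr0// subr_le0.
by rewrite max_l ?subr_ge0 ?(ltW cU)// addrC subrK.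
Qed.

Lemma integrable_excess (c : R) : 0 <= c -> P.-integrable setT (EFin \o U) ->
  P.-integrable setT (EFin \o (fun w => Num.max (U w - c) 0)).
Proof.
move=> c0 iU; apply: (le_EFin_integrable _ _ _ P _ U) => //.
  exact: measurable_excess.
move=> w; rewrite ger0_norm ?excess_ge0// ge_max U0 andbT.
by rewrite lerBlDr lerDl.
Qed.

Lemma Rintegral_excess (c : R) : 0 <= c -> P.-integrable setT (EFin \o U) ->
  \int[P]_w Num.max (U w - c) 0 =
  \int[P]_w U w - \int[P]_w Num.min (U w) c.
Proof.
move=> c0 iU; rewrite -RintegralB//; last exact: integrable_cap.
apply: eq_Rintegral => w _.
by rewrite [X in _ = X - _](cap_excess c w) addrAC subrr add0r.
Qed.

Lemma integrable_of_excess (c e : R) : 0 <= c ->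
  (\int[P]_w (Num.max (U w - c) 0)%:E <= e%:E)%E ->
  P.-integrable setT (EFin \o U) /\ \int[P]_w Num.max (U w - c) 0 <= e.
Proof.
move=> c0 le_e.
have ei : P.-integrable setT (EFin \o (fun w => Num.max (U w - c) 0)).
  apply/integrableP; split.
    by apply/measurable_EFinP; exact: measurable_excess.
  under eq_integral do rewrite /= ger0_norm ?excess_ge0//.
  by rewrite (le_lt_trans le_e)// ltry.
split; last by rewrite -lee_fin -EFin_Rintegral.
rewrite (_ : U = fun w => Num.min (U w) c + Num.max (U w - c) 0); last first.
  by apply/funext => w; exact: cap_excess.
by apply: integrable_EFinD => //; exact: integrable_cap.
Qed.

(* Monotone convergence along the increasing caps [min U k]. *)
Lemma excess_le_of_caps (c e : R) : 0 <= c ->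
  (forall k, c <= k ->
    \int[P]_w Num.min (U w) k - \int[P]_w Num.min (U w) c <= e) ->
  (\int[P]_w (Num.max (U w - c) 0)%:E <= e%:E)%E.
Proof.
move=> c0 caps.
pose g n w := Num.min (U w) (c + n%:R) - Num.min (U w) c.
have g_cvg w : (fun n => (g n w)%:E) @ \oo --> (Num.max (U w - c) 0)%:E.
  apply: cvg_near_cst; exists (Num.truncn (U w)).+1 => // n /= Un.
  rewrite /g (_ : Num.min (U w) (c + n%:R) = U w).
    by rewrite {1}(cap_excess c w) addrC addKr.
  apply: min_l; have := truncnS_gt (U w).
  have : (Num.truncn (U w)).+1%:R <= n%:R :> R by rewrite ler_nat.
  by lra.
have cn n : 0 <= c + n%:R by rewrite addr_ge0.
have mg n : measurable_fun setT (g n).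
  by apply: measurable_funB; exact: measurable_cap.
have cv : (fun n => \int[P]_w (g n w)%:E)%E @ \oo -->
    (\int[P]_w (Num.max (U w - c) 0)%:E)%E.
  have <- : (fun w => limn (fun n => (g n w)%:E)) =
      fun w => (Num.max (U w - c) 0)%:E.
    by apply/funext => w; apply/cvg_lim => //; exact: g_cvg.
  apply: cvg_monotone_convergence => // [n|n w _|w _ m n mn].
  - exact/measurable_EFinP.
  - rewrite lee_fin subr_ge0 le_min ge_min lexx/=.
    by rewrite ge_min lerDl ler0n orbT.
  - rewrite lee_fin lerB// le_min ge_min lexx/=.
    by rewrite ge_min lerD2l ler_nat mn orbT.
rewrite -(cvg_lim _ cv)//; apply: lime_le; first exact: cvgP cv.
apply: nearW => n; rewrite EFin_Rintegral.
  by rewrite lee_fin RintegralB ?integrable_cap// caps// lerDl.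
rewrite (_ : _ \o _ = ((EFin \o (fun w => Num.min (U w) (c + n%:R)%R)) \-
  (EFin \o (fun w => Num.min (U w) c)))%E)//.
by apply: integrableB => //; exact: integrable_cap.
Qed.

Lemma cap_Rintegral_cvg : P.-integrable setT (EFin \o U) ->
  (fun n => \int[P]_w Num.min (U w) n%:R) @ \oo --> \int[P]_w U w.
Proof.
move=> iU.
have [|||||_ _] := @dominated_convergence _ Omega R P setT measurableT
  (fun n w => (Num.min (U w) n%:R)%:E) (fun w => (U w)%:E) (EFin \o U).
- by move=> n; apply/measurable_EFinP; exact: measurable_cap.
- exact/measurable_EFinP.
- apply: aeW => w _; apply: cvg_near_cst.
  exists (Num.truncn (U w)).+1 => // n /= Un.
  congr EFin; apply: min_l; have := truncnS_gt (U w).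
  have : (Num.truncn (U w)).+1%:R <= n%:R :> R by rewrite ler_nat.
  by lra.
- by [].
- apply: aeW => w n _; rewrite lee_fin ger0_norm ?le_min ?U0 ?ler0n//.
  by rewrite ge_min lexx ?ler0n.
by rewrite (EFin_Rintegral _ _ _ P U iU) => /fine_cvg; exact.
Qed.

End tails.

Section small_excess.
Context (R : realType).
Context (d : measure_display) (Omega : measurableType d).
Variables (P : probability Omega R) (U : Omega -> R).
Context (d_ : nat -> measure_display) (Omega_ : forall n, measurableType (d_ n)).
Variables (P_ : forall n, probability (Omega_ n) R).
Variables (U_ : forall n, Omega_ n -> R).

(** The common consequence of both moment conditions. Integrability is recorded because the real
    integral of a nonintegrable function is only a default value, and it is asked of large [n] only
    because convergence of means says nothing about the first indices. *)
Definition small_excess : Prop := forall e : R, 0 < e -> exists2 c : R, 0 <= c &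
  (P.-integrable setT (EFin \o U) /\ \int[P]_w Num.max (U w - c) 0 <= e) /\
  \forall n \near \oo, (P_ n).-integrable setT (EFin \o U_ n) /\
    \int[P_ n]_w Num.max (U_ n w - c) 0 <= e.

Hypotheses (U0 : forall w, 0 <= U w) (U0_ : forall n w, 0 <= U_ n w).
Hypotheses (mU : measurable_fun setT U).
Hypotheses (mU_ : forall n, measurable_fun setT (U_ n)).
Hypothesis cvg_cap : forall c, 0 <= c ->
  (fun n => \int[P_ n]_w Num.min (U_ n w) c) @ \oo --> \int[P]_w Num.min (U w) c.

(** The excess over [c] is at most [U_ n] on the event [U_ n > c], hence uniformly small. The limit
    inherits the bound: for [k >= c] the difference of its means capped at [k] and [c] is a limit of
    such differences, each at most the excess of [U_ n]; then [k] tends to infinity. *)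
Lemma small_excess_of_uniformly_integrable :
  uniformly_integrable P_ U_ -> small_excess.
Proof.
move=> /fine_cvgP[sup_fin sup_cvg] e e0.
pose sup c := ereal_sup [set (\int[P_ n]_(w in [set w | (c < `|U_ n w|)%R])
  `|U_ n w|%:E)%E | n in [set: nat]].
have [c [c0 [c_fin c_le]]] : exists c : R,
    0 <= c /\ (sup c \is a fin_num /\ `|0 - fine (sup c)| <= e).
  (* Finiteness of the supremum is kept along with its size, since [fine] sends infinite values to
     [0]. *)
  near (pinfty_nbhs R) => c; exists c; split; [|split]; near: c.
  - exact: nbhs_pinfty_ge.
  - exact: sup_fin.
  - exact: (cvgr_dist_le _ _ sup_cvg).
have {}c_le : (sup c <= e%:E)%E.
  move: c_le; rewrite sub0r normrN => c_le.
  by rewrite -(fineK c_fin) lee_fin; apply: le_trans c_le; rewrite ler_norm.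
have tail n : (\int[P_ n]_w (Num.max (U_ n w - c) 0)%:E <= e%:E)%E.
  pose A := [set w | (c < `|U_ n w|)%R].
  have mA : measurable A.
    rewrite (_ : A = U_ n @^-1` `]c, +oo[).
      by rewrite -[X in measurable X]setTI; apply: mU_ => //; exact: measurable_itv.
    by apply/seteqP; split=> w; rewrite /A /= in_itv/= andbT ger0_norm.
  apply: le_trans c_le; apply: (@le_trans _ _ (\int[P_ n]_(w in A) `|U_ n w|%:E)%E).
    have -> : (\int[P_ n]_w (Num.max (U_ n w - c) 0)%:E =
        \int[P_ n]_(w in A) (Num.max (U_ n w - c) 0)%:E)%E.
      rewrite [RHS]integral_mkcond; apply: eq_integral => w _.
      rewrite patchE; case: ifPn => // /negP; rewrite inE /A /= => cU.
      congr EFin; apply: max_r; rewrite subr_le0 leNgt; apply/negP => cU'.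
      by apply: cU; rewrite ger0_norm.
    apply: ge0_le_integral => //.
    - by move=> w _; rewrite lee_fin le_max lexx orbT.
    - apply: measurable_funTS; apply/measurable_EFinP.
      exact: measurable_excess.
    - apply: measurable_funTS; apply/measurable_EFinP.
      exact: measurableT_comp.
    - move=> w _; rewrite lee_fin ge_max normr_ge0 andbT ger0_norm//.
      by rewrite lerBlDr lerDl.
  by apply: ereal_sup_ubound; exists n.
have tailR n := integrable_of_excess _ _ _ (P_ n) _ (U0_ n) (mU_ n) c e c0 (tail n).
exists c => //; split; last exact: nearW.
apply: integrable_of_excess => //; apply: excess_le_of_caps => // k ck.
have k0 : 0 <= k := le_trans c0 ck.
have cvgd : (fun n => \int[P_ n]_w Num.min (U_ n w) k -
    \int[P_ n]_w Num.min (U_ n w) c) @ \oo -->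
    \int[P]_w Num.min (U w) k - \int[P]_w Num.min (U w) c.
  by apply: cvgB; exact: cvg_cap.
rewrite -(cvg_lim _ cvgd)//; apply: limr_le; first exact: cvgP cvgd.
apply: nearW => n; have [iU le_e] := tailR n; apply: le_trans le_e.
have := Rintegral_excess _ _ _ (P_ n) _ (U0_ n) (mU_ n) c c0 iU => ->.
rewrite lerB//; apply: le_Rintegral => //; first exact: integrable_cap.
by move=> w _; rewrite ge_min lexx.
Unshelve. all: by end_near.
Qed.

(** The mean excess is the mean minus the capped mean, and both converge. A level that suits the
    limit with [e / 2] therefore suits all large [n] with [e]. *)
Lemma small_excess_of_cvg :
  (fun n => \int[P_ n]_w (U_ n w)%:E)%E @ \oo --> (\int[P]_w (U w)%:E)%E ->
  (\int[P]_w (U w)%:E < +oo)%E -> small_excess.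
Proof.
have fin_integrable (d' : measure_display) (Om : measurableType d')
    (Q : probability Om R) (V : Om -> R) : (forall w, 0 <= V w) ->
    measurable_fun setT V -> (\int[Q]_w (V w)%:E < +oo)%E ->
    Q.-integrable setT (EFin \o V).
  move=> V0 mV ltV; apply/integrableP; split; first exact/measurable_EFinP.
  by under eq_integral do rewrite /= ger0_norm//.
move=> cvgU ltU e e0.
have iU := fin_integrable _ _ P U U0 mU ltU.
move: cvgU; rewrite (EFin_Rintegral _ _ _ P U iU) => /fine_cvgP[fin_ cvgU].
have e2 : 0 < e / 2 by rewrite divr_gt0.
have [N _ /(_ N (leqnn N)) /=] :=
  cvgr_dist_le _ _ (cap_Rintegral_cvg _ _ _ P U U0 mU iU) _ e2.
have N0 : 0 <= N%:R :> R by rewrite ler0n.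
rewrite -(Rintegral_excess _ _ _ P U U0 mU N%:R N0 iU) => tailN.
have {}tailN : \int[P]_w Num.max (U w - N%:R) 0 <= e / 2.
  by apply: le_trans tailN; exact: ler_norm.
exists N%:R => //; split; first by split=> //; lra.
have cvgd : (fun n => \int[P_ n]_w U_ n w -
    \int[P_ n]_w Num.min (U_ n w) N%:R) @ \oo -->
    \int[P]_w U w - \int[P]_w Num.min (U w) N%:R.
  by apply: cvgB => //; exact: cvg_cap.
near=> n.
have fin_n : (\int[P_ n]_w (U_ n w)%:E)%E \is a fin_num.
  by near: n; exact: fin_.
have : `|\int[P]_w U w - \int[P]_w Num.min (U w) N%:R -
    (\int[P_ n]_w U_ n w - \int[P_ n]_w Num.min (U_ n w) N%:R)| <= e / 2.
  by near: n; exact: (cvgr_dist_le _ _ cvgd).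
have iUn : (P_ n).-integrable setT (EFin \o U_ n).
  by apply: fin_integrable => //; rewrite -ge0_fin_numE// integral_ge0// => w _;
    rewrite lee_fin.
rewrite -(Rintegral_excess _ _ _ P U U0 mU N%:R N0 iU).
rewrite -(Rintegral_excess _ _ _ (P_ n) _ (U0_ n) (mU_ n) N%:R N0 iUn).
by rewrite ler_norml => /andP[? ?]; split=> //; lra.
Unshelve. all: by end_near.
Qed.

End small_excess.

(** * Assembling the estimates *)

(** The excess is subadditive when the levels are added; the constant [a] is absorbed into the
    level. *)
Lemma small_excess_add (R : realType) (d : measure_display)
    (Omega : measurableType d) (P : probability Omega R) (U V : Omega -> R)
    (d_ : nat -> measure_display) (Omega_ : forall n, measurableType (d_ n))
    (P_ : forall n, probability (Omega_ n) R) (U_ V_ : forall n, Omega_ n -> R)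
    (a : R) : 0 <= a ->
  (forall w, 0 <= U w) -> (forall w, 0 <= V w) ->
  (forall n w, 0 <= U_ n w) -> (forall n w, 0 <= V_ n w) ->
  measurable_fun setT U -> measurable_fun setT V ->
  (forall n, measurable_fun setT (U_ n)) ->
  (forall n, measurable_fun setT (V_ n)) ->
  small_excess R d Omega P U d_ Omega_ P_ U_ ->
  small_excess R d Omega P V d_ Omega_ P_ V_ ->
  small_excess R d Omega P (fun w => a + U w + V w) d_ Omega_ P_
    (fun n w => a + U_ n w + V_ n w).
Proof.
move=> a0 U0 V0 U0_ V0_ mU mV mU_ mV_ seU seV e e0.
have e2 : 0 < e / 2 by rewrite divr_gt0.
have [cU cU0 [[iU leU] nU]] := seU _ e2.
have [cV cV0 [[iV leV] nV]] := seV _ e2.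
have both (d' : measure_display) (Om : measurableType d')
    (Q : probability Om R) (f g : Om -> R) :
    (forall w, 0 <= f w) -> (forall w, 0 <= g w) ->
    measurable_fun setT f -> measurable_fun setT g ->
    Q.-integrable setT (EFin \o f) -> Q.-integrable setT (EFin \o g) ->
    \int[Q]_w Num.max (f w - cU) 0 <= e / 2 ->
    \int[Q]_w Num.max (g w - cV) 0 <= e / 2 ->
    Q.-integrable setT (EFin \o (fun w => a + f w + g w)) /\
    \int[Q]_w Num.max (a + f w + g w - (a + cU + cV)) 0 <= e.
  move=> f0 g0 mf mg fi gi lef leg.
  have hi : Q.-integrable setT (EFin \o (fun w => a + f w + g w)).
    apply: integrable_EFinD => //; apply: integrable_EFinD => //.
    by apply: (bounded_integrable _ _ _ Q (fun=> a) `|a|).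
  split=> //; rewrite (splitr e).
  have h0 w : 0 <= a + f w + g w by rewrite !addr_ge0.
  have mh : measurable_fun setT (fun w => a + f w + g w).
    apply: measurable_funD => //; apply: measurable_funD => //.
  have xf := integrable_excess _ _ _ Q f f0 mf cU cU0 fi.
  have xg := integrable_excess _ _ _ Q g g0 mg cV cV0 gi.
  have c0 : 0 <= a + cU + cV by rewrite !addr_ge0.
  have xh := integrable_excess _ _ _ Q _ h0 mh _ c0 hi.
  apply: le_trans (lerD lef leg); rewrite -RintegralD//.
  apply: le_Rintegral => //; first exact: integrable_EFinD.
  move=> w _; rewrite ge_max; apply/andP; split; last first.
    by rewrite addr_ge0 ?le_max ?lexx ?orbT.
  have -> : a + f w + g w - (a + cU + cV) = (f w - cU) + (g w - cV) by ring.
  by rewrite lerD// le_max lexx.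
exists (a + cU + cV); first by rewrite !addr_ge0.
split; first exact: both.
near=> n.
have [iUn leUn] : (P_ n).-integrable setT (EFin \o U_ n) /\
    \int[P_ n]_w Num.max (U_ n w - cU) 0 <= e / 2 by near: n.
have [iVn leVn] : (P_ n).-integrable setT (EFin \o V_ n) /\
    \int[P_ n]_w Num.max (V_ n w - cV) 0 <= e / 2 by near: n.
by apply: both.
Unshelve. all: by end_near.
Qed.

(** * The sum metric and the product topology *)

Section pair_continuity.
Context (R : realType) (TX TY : metricType R).
Let S : topologicalType := (TX * TY)%type.

Lemma continuous_pair_dist (t : S) :
  continuous (fun s : S => pair_dist R TX TY s t).
Proof.
move=> s; apply: cvgD.
  by apply: (cvg_comp fst (fun x => mdist x t.1) cvg_fst); exact: continuous_mdist.
by apply: (cvg_comp snd (fun x => mdist x t.2) cvg_snd); exact: continuous_mdist.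
Qed.

(** Passes from the sum metric, in which the estimates are made, to the product topology, in which
    convergence in distribution is tested. *)
Lemma pair_unif_continuous (f : S -> R) :
  (forall e, 0 < e -> exists2 del, 0 < del & forall s t : S,
    pair_dist R TX TY s t < del -> `|f s - f t| <= e) ->
  continuous f.
Proof.
move=> fuc s; apply/cvgrPdist_le => e e0.
have [del del0 fdel] := fuc e e0.
near=> t.
have : `|pair_dist R TX TY s s - pair_dist R TX TY t s| < del.
  by near: t; exact: (cvgr_dist_lt _ _ (continuous_pair_dist s s)).
rewrite pair_distxx sub0r normrN => /(le_lt_trans (ler_norm _)) ts.
by rewrite distrC fdel.
Unshelve. all: by end_near.
Qed.

Lemma capped_moment_continuous (al c : R) (p : S -> R) :
  0 < al -> 0 <= c -> (forall s, 0 <= p s) ->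
  (forall s t, `|p s - p t| <= pair_dist R TX TY s t) ->
  continuous (fun s : S => Num.min (p s `^ al) c).
Proof.
(* The cap is moved inside the power, [min (p^al) c = (min p k)^al], so that the power is needed
   only on [[0, k]], where it is uniformly continuous. *)
move=> al0 c0 p0 pl; pose k := c `^ al^-1.
have k0 : 0 <= k by apply: powR_ge0.
have kE : k `^ al = c by rewrite /k -powRrM mulVf ?gt_eqF// powRr1.
have [c_le c_lip] := lipschitz_cut_min R k k0.
have minE s : Num.min (p s `^ al) c = Num.min (p s) k `^ al.
  rewrite -[in LHS]kE; have [pk|kp] := leP (p s) k.
    by rewrite min_l// ge0_ler_powR ?nnegrE ?(ltW al0).
  by rewrite min_r// ge0_ler_powR ?nnegrE ?(ltW al0) ?(ltW kp).
apply: pair_unif_continuous => e e0.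
have [del del0 key] := powR_unif_cont R al k e al0 k0 e0.
exists del => // s t st; rewrite !minE; apply: key.
- by have /andP[] := c_le _ (p0 s).
- by have /andP[] := c_le _ (p0 t).
- by rewrite ge_min lexx orbT.
- by rewrite ge_min lexx orbT.
exact: le_lt_trans (c_lip _ _ (p0 s) (p0 t)) (le_lt_trans (pl s t) st).
Qed.

End pair_continuity.

Section measurable_pairs.
Context (R : realType) (TX TY : metricType R).

(** Measurability through distances to fixed points: it holds for constants, is stable under
    composition, and suffices for the kernels on separable spaces. *)
Definition dist_measurable (d : measure_display) (Omega : measurableType d)
    (A : Omega -> TX * TY) : Prop :=
  (forall t, measurable_fun setT (fun w => mdist (A w).1 t)) /\
  (forall t, measurable_fun setT (fun w => mdist (A w).2 t)).

Lemma dist_measurable_cst (d : measure_display) (Omega : measurableType d) s :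
  dist_measurable d Omega (fun=> s).
Proof. by split=> t; exact: measurable_cst. Qed.

Lemma dist_measurable_comp (d d' : measure_display) (Omega : measurableType d)
    (Omega' : measurableType d') (A : Omega -> TX * TY) (f : Omega' -> Omega) :
  measurable_fun setT f -> dist_measurable d Omega A ->
  dist_measurable d' Omega' (fun w => A (f w)).
Proof.
move=> mf [mA1 mA2]; split=> t; first exact: (measurableT_comp (mA1 t) mf).
exact: (measurableT_comp (mA2 t) mf).
Qed.

Lemma measurable_cut_hat (d : measure_display) (Omega : measurableType d)
    (T : metricType R) (s : nat -> T) (c : R -> R) (al : R)
    (A1 A2 A3 A4 : Omega -> T) :
  (forall x del, 0 < del -> exists k, mdist x (s k) < del) ->
  measurable_fun setT c ->
  (forall t, measurable_fun setT (fun w => mdist (A1 w) t)) ->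
  (forall t, measurable_fun setT (fun w => mdist (A2 w) t)) ->
  (forall t, measurable_fun setT (fun w => mdist (A3 w) t)) ->
  (forall t, measurable_fun setT (fun w => mdist (A4 w) t)) ->
  measurable_fun setT (fun w => cut_hat R T c al (A1 w) (A2 w) (A3 w) (A4 w)).
Proof.
move=> sd mc m1 m2 m3 m4.
have mp (A B : Omega -> T) :
    (forall t, measurable_fun setT (fun w => mdist (A w) t)) ->
    (forall t, measurable_fun setT (fun w => mdist (B w) t)) ->
    measurable_fun setT (fun w => c (mdist (A w) (B w)) `^ al).
  move=> mA mB; have mAB := measurable_mdist2 R d Omega T s A B sd mA mB.
  exact: (measurableT_comp (measurable_powR al) (measurableT_comp mc mAB)).
apply: measurable_funB; last exact: mp.
apply: measurable_funD; last exact: mp.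
by apply: measurable_funB; exact: mp.
Qed.

Lemma measurable_cut_kernel (d : measure_display) (Omega : measurableType d)
    (sX : nat -> TX) (sY : nat -> TY) (c : R -> R) (al : R)
    (A1 A2 A3 A4 : Omega -> TX * TY) :
  (forall x del, 0 < del -> exists k, mdist x (sX k) < del) ->
  (forall x del, 0 < del -> exists k, mdist x (sY k) < del) ->
  measurable_fun setT c ->
  dist_measurable d Omega A1 -> dist_measurable d Omega A2 ->
  dist_measurable d Omega A3 -> dist_measurable d Omega A4 ->
  measurable_fun setT
    (fun w => cut_kernel R TX TY al c (A1 w) (A2 w) (A3 w) (A4 w)).
Proof.
move=> sdX sdY mc [m1 m1'] [m2 m2'] [m3 m3'] [m4 m4'].
apply: measurable_funM.
  exact: (measurable_cut_hat _ _ _ sX).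
exact: (measurable_cut_hat _ _ _ sY).
Qed.

End measurable_pairs.

(** * Convergence for the truncated kernel *)

Section assembly.
Context (R : realType) (al : R) (TX TY : metricType R) (xo : TX) (yo : TY).
Context (d : measure_display) (Omega : measurableType d).
Variables (P : probability Omega R) (X : Omega -> TX) (Y : Omega -> TY).
Context (d_ : nat -> measure_display) (Omega_ : forall n, measurableType (d_ n)).
Variables (P_ : forall n, probability (Omega_ n) R).
Variables (X_ : forall n, Omega_ n -> TX) (Y_ : forall n, Omega_ n -> TY).
Hypothesis al0 : 0 < al.
Hypotheses (sepX : separable TX) (sepY : separable TY).
Hypotheses (mX : borel_measurable X) (mY : borel_measurable Y).
Hypotheses (mX_ : forall n, borel_measurable (X_ n)).
Hypotheses (mY_ : forall n, borel_measurable (Y_ n)).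
Hypothesis cvgXY : cvg_in_distribution P_ (fun n w => (X_ n w, Y_ n w)) P
  (fun w => (X w, Y w)).

Let S : topologicalType := (TX * TY)%type.
Let Z w : S := (X w, Y w).
Let Z_ n w : S := (X_ n w, Y_ n w).

Let dmZ : dist_measurable R TX TY d Omega Z.
Proof. by split=> t; exact: measurable_mdist. Qed.

Let dmZ_ n : dist_measurable R TX TY (d_ n) (Omega_ n) (Z_ n).
Proof. by split=> t; exact: measurable_mdist. Qed.

Lemma cvg_in_distribution_Rintegral (f : S -> R) (B : R) : continuous f ->
  (forall s, `|f s| <= B) -> measurable_fun setT (fun w => f (Z w)) ->
  (forall n, measurable_fun setT (fun w => f (Z_ n w))) ->
  (fun n => \int[P_ n]_w f (Z_ n w)) @ \oo --> \int[P]_w f (Z w).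
Proof.
move=> cf fB mf mf_.
have bf : bounded_fun f.
  exists B; split=> [|x Bx y _]; first exact: num_real.
  exact: le_trans (fB y) (ltW Bx).
have := cvgXY f cf bf; rewrite unlock.
rewrite (EFin_Rintegral _ _ _ P (fun w => f (Z w))).
  by move=> /fine_cvg; exact.
exact: (bounded_integrable _ _ _ P _ B).
Qed.

Let measurable_kernel (d' : measure_display) (Om : measurableType d')
    (c : R -> R) (A1 A2 A3 A4 : Om -> S) : measurable_fun setT c ->
  dist_measurable R TX TY d' Om A1 -> dist_measurable R TX TY d' Om A2 ->
  dist_measurable R TX TY d' Om A3 -> dist_measurable R TX TY d' Om A4 ->
  measurable_fun setT
    (fun w => cut_kernel R TX TY al c (A1 w) (A2 w) (A3 w) (A4 w)).
Proof.
have [sX sdX] := separable_seq R TX xo sepX.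
have [sY sdY] := separable_seq R TY yo sepY.
move=> mc m1 m2 m3 m4.
exact: (measurable_cut_kernel _ _ _ _ _ sX sY c al A1 A2 A3 A4 sdX sdY mc).
Qed.

Let measurable_pair_dist (d' : measure_display) (Om : measurableType d')
    (A : Om -> S) (t : S) : dist_measurable R TX TY d' Om A ->
  measurable_fun setT (fun w => pair_dist R TX TY (A w) t).
Proof. by move=> [mA1 mA2]; exact: measurable_funD. Qed.

Lemma separable_pair_seq : exists s : nat -> S,
  forall x e, 0 < e -> exists k, pair_dist R TX TY x (s k) < e.
Proof.
have [sX sdX] := separable_seq R TX xo sepX.
have [sY sdY] := separable_seq R TY yo sepY.
(* Pairs of indices are coded by naturals; [(xo, yo)] is the default for a number that codes no
   pair. *)
exists (fun k => if unpickle k is Some (i, j) then (sX i, sY j) else (xo, yo)).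
move=> x e e0; have e2 : 0 < e / 2 by rewrite divr_gt0.
have [i xi] := sdX x.1 _ e2; have [j xj] := sdY x.2 _ e2.
exists (pickle (i, j)); rewrite pickleK /pair_dist/= (splitr e).
exact: ltrD.
Qed.

(** The copies become random one at a time. Each stage holds for all frozen values of the remaining
    arguments, which is the pointwise hypothesis of the next one; the copies already treated are
    bundled into [W]. The base case is convergence in distribution. *)
Lemma cvg_cut_kernel (M : R) : 0 <= M ->
  (fun n => \int[(P_ n \x P_ n \x P_ n \x P_ n)%E]_w
     cut_kernel R TX TY al (Num.min ^~ M)
       (Z_ n w.1.1.1) (Z_ n w.1.1.2) (Z_ n w.1.2) (Z_ n w.2)) @ \oo -->
  \int[(P \x P \x P \x P)%E]_w cut_kernel R TX TY al (Num.min ^~ M)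
       (Z w.1.1.1) (Z w.1.1.2) (Z w.1.2) (Z w.2).
Proof.
move=> M0; set ck := cut_kernel R TX TY al (Num.min ^~ M).
have [s sd] := separable_pair_seq.
pose B := 2 * M `^ al * (2 * M `^ al).
have ckB s1 s2 s3 s4 : `|ck s1 s2 s3 s4| <= B by exact: cut_kernel_min_bound.
have uc e (e0 : 0 < e) := cut_kernel_unif_cont R TX TY al M e al0 M0 e0.
have mc : measurable_fun setT (fun p : R => Num.min p M).
  by apply: measurable_minr => //; exact: measurable_cst.
have mk (d' : measure_display) (Om : measurableType d')
    (A1 A2 A3 A4 : Om -> S) :=
  measurable_kernel d' Om (Num.min ^~ M) A1 A2 A3 A4 mc.
have dcst := dist_measurable_cst R TX TY.
have dcomp := dist_measurable_comp R TX TY.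
have step (T : Type) (d1 : measure_display) (Om1 : measurableType d1)
    (Q : probability Om1 R) (W : Om1 -> T) (d1_ : nat -> measure_display)
    (Om1_ : forall n, measurableType (d1_ n))
    (Q_ : forall n, probability (Om1_ n) R) (W_ : forall n, Om1_ n -> T)
    (F : T -> S -> R) :=
  cvg_prod_Rintegral R S T (pair_dist R TX TY) s d1 d Om1 Omega Q P W Z d1_ d_
    Om1_ Omega_ Q_ P_ W_ Z_ F B (continuous_pair_dist R TX TY) sd
    (fun t => measurable_pair_dist _ _ _ t dmZ)
    (fun n t => measurable_pair_dist _ _ _ t (dmZ_ n))
    (fun f cf f1 mf mf_ => cvg_in_distribution_Rintegral f 1 cf f1 mf mf_).
have c1 s2 s3 s4 : (fun n => \int[P_ n]_w ck (Z_ n w) s2 s3 s4) @ \oo -->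
    \int[P]_w ck (Z w) s2 s3 s4.
  apply: (cvg_in_distribution_Rintegral (fun x => ck x s2 s3 s4) B) => //.
  - apply: pair_unif_continuous => e e0; have [del del0 h] := uc e e0.
    by exists del => // x y xy; apply: h; rewrite ?pair_distxx.
  - by apply: mk.
  - by move=> n; apply: mk.
have c2 s3 s4 : (fun n => \int[(P_ n \x P_ n)%E]_w
      ck (Z_ n w.1) (Z_ n w.2) s3 s4) @ \oo -->
    \int[(P \x P)%E]_w ck (Z w.1) (Z w.2) s3 s4.
  apply: (step S _ _ P Z _ _ P_ Z_ (fun t x => ck t x s3 s4)) => //.
  - move=> e e0; have [del del0 h] := uc e e0.
    by exists del => // x y xy t; apply: h; rewrite ?pair_distxx.
  - apply: mk => //; apply: dcomp => //.
  - by move=> n; apply: mk => //; apply: dcomp.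
  - by move=> x; apply: mk.
  - by move=> n x; apply: mk.
have c3 s4 : (fun n => \int[(P_ n \x P_ n \x P_ n)%E]_w
      ck (Z_ n w.1.1) (Z_ n w.1.2) (Z_ n w.2) s4) @ \oo -->
    \int[(P \x P \x P)%E]_w ck (Z w.1.1) (Z w.1.2) (Z w.2) s4.
  apply: (step (S * S)%type _ _ (P \x P)%E (fun w => (Z w.1, Z w.2)) _ _
    (fun n => (P_ n \x P_ n)%E) (fun n w => (Z_ n w.1, Z_ n w.2))
    (fun t x => ck t.1 t.2 x s4)) => //.
  - move=> e e0; have [del del0 h] := uc e e0.
    by exists del => // x y xy t; apply: h; rewrite ?pair_distxx.
  - apply: mk => //; apply: dcomp => //; exact: measurableT_comp.
  - by move=> n; apply: mk => //; apply: dcomp => //; exact: measurableT_comp.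
  - by move=> x; apply: mk => //; apply: dcomp.
  - by move=> n x; apply: mk => //; apply: dcomp.
apply: (step (S * S * S)%type _ _ (P \x P \x P)%E
  (fun w => (Z w.1.1, Z w.1.2, Z w.2)) _ _
  (fun n => (P_ n \x P_ n \x P_ n)%E)
  (fun n w => (Z_ n w.1.1, Z_ n w.1.2, Z_ n w.2))
  (fun t x => ck t.1.1 t.1.2 t.2 x)) => //.
- move=> e e0; have [del del0 h] := uc e e0.
  by exists del => // x y xy t; apply: h; rewrite ?pair_distxx.
- by apply: mk => //; apply: dcomp => //; do ?apply: measurableT_comp.
- by move=> n; apply: mk => //; apply: dcomp => //; do ?apply: measurableT_comp.
- by move=> x; apply: mk => //; apply: dcomp => //; do ?apply: measurableT_comp.
- by move=> n x; apply: mk => //; apply: dcomp => //;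
    do ?apply: measurableT_comp.
Qed.

End assembly.

(** * The error made by truncating the metric *)

Section truncation_error.
Context (R : realType) (al : R) (TX TY : metricType R) (xo : TX) (yo : TY).
Hypothesis al0 : 0 < al.
Let wt := moment_weight R TX TY xo yo (alpha_star al).
Let ck := cut_kernel R TX TY al.
Let excess c s := Num.max (wt s - c) 0.

Lemma alpha_star_gt0 : 0 < alpha_star al.
Proof. by rewrite /alpha_star lt_max al0. Qed.

Lemma moment_weight_ge0 s : 0 <= wt s.
Proof. by rewrite /wt /moment_weight !addr_ge0 ?powR_ge0. Qed.

(** A weight at most [2 * c] forces both norms below [(2 * c)^(1 / alpha_star)]; the factor [2] is
    the triangle inequality through the base point. *)
Definition cut_level (c : R) : R := 2 * (2 * c) `^ (alpha_star al)^-1.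

Lemma cut_level_ge0 c : 0 <= cut_level c.
Proof. by rewrite mulr_ge0 ?powR_ge0. Qed.

Lemma cut_kernel_level_eq (c : R) s1 s2 s3 s4 : 0 <= c ->
  wt s1 <= 2 * c -> wt s2 <= 2 * c -> wt s3 <= 2 * c -> wt s4 <= 2 * c ->
  ck (Num.min ^~ (cut_level c)) s1 s2 s3 s4 = ck id s1 s2 s3 s4.
Proof.
move=> c0 w1 w2 w3 w4; pose m := (2 * c) `^ (alpha_star al)^-1.
have as0 := alpha_star_gt0.
have root p : 0 <= p -> p `^ alpha_star al <= 2 * c -> p <= m.
  move=> p0 pc; rewrite -[leLHS](powRr1 p0).
  have -> : 1 = alpha_star al * (alpha_star al)^-1 by rewrite divff ?gt_eqF.
  rewrite powRrM; apply: ge0_ler_powR; rewrite ?nnegrE ?powR_ge0 ?mulr_ge0//.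
  by rewrite invr_ge0 ltW.
have small s : wt s <= 2 * c -> mdist s.1 xo <= m /\ mdist s.2 yo <= m.
  rewrite /wt /moment_weight => ws.
  have a0 := powR_ge0 (mdist s.1 xo) (alpha_star al).
  have b0 := powR_ge0 (mdist s.2 yo) (alpha_star al).
  by split; apply: root; rewrite ?mdist_ge0//; lra.
have dist_le (T : metricType R) (o x y : T) : mdist x o <= m ->
    mdist y o <= m -> mdist x y <= cut_level c.
  move=> xm ym; apply: le_trans (metric_triangle _ o _) _.
  by rewrite (metric_sym o) /cut_level -/m; lra.
have [a1 b1] := small _ w1; have [a2 b2] := small _ w2.
have [a3 b3] := small _ w3; have [a4 b4] := small _ w4.
by apply: cut_kernel_min_eq; (apply: dist_le; eassumption).
Qed.

(** If all weights are at most [2 * c], the truncation changes nothing. Otherwise some weight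
    exceeds [2 * c] and is at most twice its excess over [c], which is why the threshold is twice
    the level. Two kernels and this factor two give [4 * K]. *)
Lemma cut_kernel_error (K c : R) s1 s2 s3 s4 : 0 <= K -> 0 <= c ->
  (forall c s1 s2 s3 s4, lipschitz_cut R c ->
    `|ck c s1 s2 s3 s4| <= K * (wt s1 * wt s2 * wt s3 * wt s4)) ->
  `|ck id s1 s2 s3 s4 - ck (Num.min ^~ (cut_level c)) s1 s2 s3 s4| <=
  4 * K * (excess c s1 * wt s2 * wt s3 * wt s4 +
           wt s1 * excess c s2 * wt s3 * wt s4 +
           wt s1 * wt s2 * excess c s3 * wt s4 +
           wt s1 * wt s2 * wt s3 * excess c s4).
Proof.
move=> K0 c0 ckB; set r := excess c.
have bid := ckB id s1 s2 s3 s4 (lipschitz_cut_id R).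
have bmin := ckB _ s1 s2 s3 s4 (lipschitz_cut_min R _ (cut_level_ge0 c)).
have r0 s : 0 <= r s by rewrite /r /excess le_max lexx orbT.
have rw s : 2 * c < wt s -> wt s <= 2 * r s.
  by move=> cw; rewrite /r /excess max_l; lra.
have w0 := moment_weight_ge0.
have W1 := w0 s1; have W2 := w0 s2; have W3 := w0 s3; have W4 := w0 s4.
have t1 : 0 <= r s1 * wt s2 * wt s3 * wt s4 by rewrite !mulr_ge0.
have t2 : 0 <= wt s1 * r s2 * wt s3 * wt s4 by rewrite !mulr_ge0.
have t3 : 0 <= wt s1 * wt s2 * r s3 * wt s4 by rewrite !mulr_ge0.
have t4 : 0 <= wt s1 * wt s2 * wt s3 * r s4 by rewrite !mulr_ge0.
have large : wt s1 * wt s2 * wt s3 * wt s4 <=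
    2 * (r s1 * wt s2 * wt s3 * wt s4 + wt s1 * r s2 * wt s3 * wt s4 +
         wt s1 * wt s2 * r s3 * wt s4 + wt s1 * wt s2 * wt s3 * r s4) ->
    `|ck id s1 s2 s3 s4 - ck (Num.min ^~ (cut_level c)) s1 s2 s3 s4| <=
    4 * K * (r s1 * wt s2 * wt s3 * wt s4 + wt s1 * r s2 * wt s3 * wt s4 +
             wt s1 * wt s2 * r s3 * wt s4 + wt s1 * wt s2 * wt s3 * r s4).
  move=> le2; apply: le_trans (ler_normB _ _) _.
  apply: le_trans (lerD bid bmin) _.
  by have := ler_wpM2l K0 le2; lra.
have [h1|/rw h1] := leP (wt s1) (2 * c); last first.
  apply: large; apply: (@le_trans _ _ (2 * r s1 * wt s2 * wt s3 * wt s4)).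
    by do 3![apply: ler_wpM2r => //].
  by lra.
have [h2|/rw h2] := leP (wt s2) (2 * c); last first.
  apply: large; apply: (@le_trans _ _ (wt s1 * (2 * r s2) * wt s3 * wt s4)).
    by do 2![apply: ler_wpM2r => //]; apply: ler_wpM2l.
  by lra.
have [h3|/rw h3] := leP (wt s3) (2 * c); last first.
  apply: large; apply: (@le_trans _ _ (wt s1 * wt s2 * (2 * r s3) * wt s4)).
    by apply: ler_wpM2r => //; apply: ler_wpM2l => //; rewrite mulr_ge0.
  by lra.
have [h4|/rw h4] := leP (wt s4) (2 * c); last first.
  apply: large; apply: (@le_trans _ _ (wt s1 * wt s2 * wt s3 * (2 * r s4))).
    by apply: ler_wpM2l => //; rewrite !mulr_ge0.
  by lra.
rewrite cut_kernel_level_eq// subrr normr0.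
by rewrite !mulr_ge0// !addr_ge0.
Qed.

(** The domination also yields integrability of the untruncated kernel, so that [dcov] is finite.
    The constant is [4 * K] for each of four equal summands. *)
Lemma Rintegral_cut_kernel_error (d : measure_display) (Om : measurableType d)
    (P : probability Om R) (A : Om -> TX * TY) (K c : R) : 0 <= K -> 0 <= c ->
  (forall c s1 s2 s3 s4, lipschitz_cut R c ->
    `|ck c s1 s2 s3 s4| <= K * (wt s1 * wt s2 * wt s3 * wt s4)) ->
  measurable_fun setT (fun w => wt (A w)) ->
  (forall c : R -> R, measurable_fun setT c -> measurable_fun setT
    (fun w : Om * Om * Om * Om =>
       ck c (A w.1.1.1) (A w.1.1.2) (A w.1.2) (A w.2))) ->
  P.-integrable setT (EFin \o (fun w => wt (A w))) ->
  (P \x P \x P \x P)%E.-integrable setT (EFin \o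
    (fun w => ck id (A w.1.1.1) (A w.1.1.2) (A w.1.2) (A w.2))) /\
  `|\int[(P \x P \x P \x P)%E]_w ck id (A w.1.1.1) (A w.1.1.2) (A w.1.2) (A w.2)
    - \int[(P \x P \x P \x P)%E]_w
        ck (Num.min ^~ (cut_level c)) (A w.1.1.1) (A w.1.1.2) (A w.1.2) (A w.2)|
  <= 16 * K * (\int[P]_w Num.max (wt (A w) - c) 0) *
     (\int[P]_w wt (A w)) ^+ 3.
Proof.
move=> K0 c0 ckB mw mck iw.
have w0 w := moment_weight_ge0 (A w).
have mid := mck id (@measurable_id _ _ _).
have mmin : measurable_fun setT (fun p : R => Num.min p (cut_level c)).
  by apply: measurable_minr => //; exact: measurable_cst.
have i4 := integrable_EFinZl _ _ _ (P \x P \x P \x P)%E K _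
  (integrable_prod4 _ _ _ P _ _ _ _ iw iw iw iw).
have kid : (P \x P \x P \x P)%E.-integrable setT (EFin \o
    (fun w => ck id (A w.1.1.1) (A w.1.1.2) (A w.1.2) (A w.2))).
  apply: (le_EFin_integrable _ _ _ _ _ _ mid i4) => w.
  exact: ckB (lipschitz_cut_id R).
have kmin : (P \x P \x P \x P)%E.-integrable setT (EFin \o
    (fun w => ck (Num.min ^~ (cut_level c))
      (A w.1.1.1) (A w.1.1.2) (A w.1.2) (A w.2))).
  apply: (le_EFin_integrable _ _ _ _ _ _ (mck _ mmin) i4) => w.
  exact: ckB (lipschitz_cut_min R _ (cut_level_ge0 c)).
split=> //; rewrite -RintegralB//.
have ir := integrable_excess _ _ _ P _ w0 mw c c0 iw.
have mG := measurable_funB mid (mck _ mmin).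
have := Rintegral4_tail _ _ _ P _ _ _ (4 * K) iw ir mG _.
rewrite mulrA (_ : 4 * 4 = 16) => [|]; last by ring.
by apply=> w; exact: cut_kernel_error.
Qed.

End truncation_error.

(** The factor [1/4] in [dcov] absorbs three errors of size [e]. *)
Lemma quarter_dist (R : realType) (a a' b b' e : R) :
  `|a - a'| <= e -> `|b - b'| <= e -> `|a' - b'| <= e ->
  `|4^-1 * a - 4^-1 * b| <= e.
Proof.
rewrite !ler_norml => /andP[? ?] /andP[? ?] /andP[? ?].
by apply/andP; split; lra.
Qed.

(** * From the moment conditions to the distance covariance *)

Section moments.
Context (R : realType) (al : R) (TX TY : metricType R) (xo : TX) (yo : TY).
Context (d : measure_display) (Omega : measurableType d).
Variables (P : probability Omega R) (X : Omega -> TX) (Y : Omega -> TY).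
Context (d_ : nat -> measure_display) (Omega_ : forall n, measurableType (d_ n)).
Variables (P_ : forall n, probability (Omega_ n) R).
Variables (X_ : forall n, Omega_ n -> TX) (Y_ : forall n, Omega_ n -> TY).
Hypothesis al0 : 0 < al.
Hypotheses (sepX : separable TX) (sepY : separable TY).
Hypotheses (mX : borel_measurable X) (mY : borel_measurable Y).
Hypotheses (mX_ : forall n, borel_measurable (X_ n)).
Hypotheses (mY_ : forall n, borel_measurable (Y_ n)).
Hypothesis cvgXY : cvg_in_distribution P_ (fun n w => (X_ n w, Y_ n w)) P
  (fun w => (X w, Y w)).

Let wt := moment_weight R TX TY xo yo (alpha_star al).

Lemma measurable_moment (d' : measure_display) (Om : measurableType d')
    (T : metricType R) (A : Om -> T) (o : T) (p : R) : borel_measurable A ->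
  measurable_fun setT (fun w => mdist (A w) o `^ p).
Proof.
move=> mA.
exact: (measurableT_comp (measurable_powR p) (measurable_mdist R _ _ T A o mA)).
Qed.

Lemma moment_small_excess :
  small_excess R d Omega P (fun w => mdist (X w) xo `^ alpha_star al)
    d_ Omega_ P_ (fun n w => mdist (X_ n w) xo `^ alpha_star al) ->
  small_excess R d Omega P (fun w => mdist (Y w) yo `^ alpha_star al)
    d_ Omega_ P_ (fun n w => mdist (Y_ n w) yo `^ alpha_star al) ->
  small_excess R d Omega P (fun w => wt (X w, Y w))
    d_ Omega_ P_ (fun n w => wt (X_ n w, Y_ n w)).
Proof.
apply: (small_excess_add R d Omega P
  (fun w => mdist (X w) xo `^ alpha_star al)
  (fun w => mdist (Y w) yo `^ alpha_star al) d_ Omega_ P_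
  (fun n w => mdist (X_ n w) xo `^ alpha_star al)
  (fun n w => mdist (Y_ n w) yo `^ alpha_star al) 2 (ler0n R 2)).
- by move=> w; exact: powR_ge0.
- by move=> w; exact: powR_ge0.
- by move=> n w; exact: powR_ge0.
- by move=> n w; exact: powR_ge0.
- exact: (measurable_moment _ _ _ X xo _ mX).
- exact: (measurable_moment _ _ _ Y yo _ mY).
- by move=> n; exact: (measurable_moment _ _ _ (X_ n) xo _ (mX_ n)).
- by move=> n; exact: (measurable_moment _ _ _ (Y_ n) yo _ (mY_ n)).
Qed.

Lemma cvg_capX c : 0 <= c ->
  (fun n => \int[P_ n]_w Num.min (mdist (X_ n w) xo `^ alpha_star al) c) @ \oo
  --> \int[P]_w Num.min (mdist (X w) xo `^ alpha_star al) c.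
Proof.
move=> c0.
apply: (cvg_in_distribution_Rintegral R TX TY d Omega P X Y d_ Omega_ P_ X_ Y_
  cvgXY (fun s => Num.min (mdist s.1 xo `^ alpha_star al) c) c).
- apply: capped_moment_continuous => // [|s|s t].
  + exact: alpha_star_gt0.
  + exact: mdist_ge0.
  + rewrite (le_trans (mdist_dist _ _ _ _ _))//.
    by rewrite /pair_dist lerDl mdist_ge0.
- by move=> s; rewrite ger0_norm ?ge_min ?lexx ?orbT// le_min powR_ge0.
- by apply: measurable_cap; exact: measurable_moment.
- by move=> n; apply: measurable_cap; exact: measurable_moment.
Qed.

Lemma cvg_capY c : 0 <= c ->
  (fun n => \int[P_ n]_w Num.min (mdist (Y_ n w) yo `^ alpha_star al) c) @ \oo
  --> \int[P]_w Num.min (mdist (Y w) yo `^ alpha_star al) c.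
Proof.
move=> c0.
apply: (cvg_in_distribution_Rintegral R TX TY d Omega P X Y d_ Omega_ P_ X_ Y_
  cvgXY (fun s => Num.min (mdist s.2 yo `^ alpha_star al) c) c).
- apply: capped_moment_continuous => // [|s|s t].
  + exact: alpha_star_gt0.
  + exact: mdist_ge0.
  + rewrite (le_trans (mdist_dist _ _ _ _ _))//.
    by rewrite /pair_dist lerDr mdist_ge0.
- by move=> s; rewrite ger0_norm ?ge_min ?lexx ?orbT// le_min powR_ge0.
- by apply: measurable_cap; exact: measurable_moment.
- by move=> n; apply: measurable_cap; exact: measurable_moment.
Qed.

Lemma dcovE (d' : measure_display) (Om : measurableType d')
    (Q : probability Om R) (A : Om -> TX) (B : Om -> TY) :
  dcov al Q A B = (4^-1%:E * \int[Q \x Q \x Q \x Q]_w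
    (cut_kernel R TX TY al id (A w.1.1.1, B w.1.1.1) (A w.1.1.2, B w.1.1.2)
      (A w.1.2, B w.1.2) (A w.2, B w.2))%:E)%E.
Proof.
by rewrite /dcov; congr (_ * _)%E; apply: eq_integral => -[[[w1 w2] w3] w4] _.
Qed.

Lemma cvg_dcov :
  small_excess R d Omega P (fun w => wt (X w, Y w))
    d_ Omega_ P_ (fun n w => wt (X_ n w, Y_ n w)) ->
  (fun n => dcov al (P_ n) (X_ n) (Y_ n)) @ \oo --> dcov al P X Y.
Proof.
move=> se.
have [K K0 ckB] := cut_kernel_bound R TX TY al xo yo al0.
have [sX sdX] := separable_seq R TX xo sepX.
have [sY sdY] := separable_seq R TY yo sepY.
have w0 := moment_weight_ge0 R al TX TY xo yo.
have mwt (d' : measure_display) (Om : measurableType d') (A : Om -> TX)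
    (B : Om -> TY) : borel_measurable A -> borel_measurable B ->
    measurable_fun setT (fun w => wt (A w, B w)).
  move=> mA mB; apply: measurable_funD; last exact: measurable_moment.
  by apply: measurable_funD => //; exact: measurable_moment.
have mck (d' : measure_display) (Om : measurableType d') (A : Om -> TX)
    (B : Om -> TY) (c : R -> R) : borel_measurable A -> borel_measurable B ->
    measurable_fun setT c -> measurable_fun setT (fun w : Om * Om * Om * Om =>
      cut_kernel R TX TY al c (A w.1.1.1, B w.1.1.1) (A w.1.1.2, B w.1.1.2)
      (A w.1.2, B w.1.2) (A w.2, B w.2)).
  move=> mA mB mc.
  have dm : dist_measurable R TX TY d' Om (fun w => (A w, B w)).
    by split=> t; exact: measurable_mdist.
  have dcomp := dist_measurable_comp R TX TY.
  apply: (measurable_cut_kernel _ _ _ _ _ sX sY c al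
    (fun w : Om * Om * Om * Om => (A w.1.1.1, B w.1.1.1))
    (fun w => (A w.1.1.2, B w.1.1.2)) (fun w => (A w.1.2, B w.1.2))
    (fun w => (A w.2, B w.2)) sdX sdY mc).
  - by apply: (dcomp _ _ _ _ _ (fun w => w.1.1.1)) dm;
      do ?apply: measurableT_comp.
  - by apply: (dcomp _ _ _ _ _ (fun w => w.1.1.2)) dm;
      do ?apply: measurableT_comp.
  - by apply: (dcomp _ _ _ _ _ (fun w => w.1.2)) dm;
      do ?apply: measurableT_comp.
  - exact: (dcomp _ _ _ _ _ snd measurable_snd dm).
pose ker (d' : measure_display) (Om : measurableType d') (A : Om -> TX)
    (B : Om -> TY) (c : R -> R) (w : Om * Om * Om * Om) :=
  cut_kernel R TX TY al c (A w.1.1.1, B w.1.1.1) (A w.1.1.2, B w.1.1.2)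
    (A w.1.2, B w.1.2) (A w.2, B w.2).
have error (d' : measure_display) (Om : measurableType d')
    (Q : probability Om R) (A : Om -> TX) (B : Om -> TY) (c : R) :
    borel_measurable A -> borel_measurable B -> 0 <= c ->
    Q.-integrable setT (EFin \o (fun w => wt (A w, B w))) ->
    (Q \x Q \x Q \x Q)%E.-integrable setT (EFin \o ker _ _ A B id) /\
    `|\int[(Q \x Q \x Q \x Q)%E]_w ker _ _ A B id w -
      \int[(Q \x Q \x Q \x Q)%E]_w
        ker _ _ A B (Num.min ^~ (cut_level R al c)) w| <=
    16 * K * (\int[Q]_w Num.max (wt (A w, B w) - c) 0) *
      (\int[Q]_w wt (A w, B w)) ^+ 3.
  move=> mA mB c0 iw.
  exact: (Rintegral_cut_kernel_error R al TX TY xo yo al0 d' Om Q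
    (fun w => (A w, B w)) K c K0 c0 ckB (mwt _ _ _ _ mA mB)
    (fun c' => mck _ _ A B c' mA mB) iw).
have first_moment (d' : measure_display) (Om : measurableType d')
    (Q : probability Om R) (A : Om -> TX) (B : Om -> TY) (c e : R) :
    borel_measurable A -> borel_measurable B -> 0 <= c ->
    Q.-integrable setT (EFin \o (fun w => wt (A w, B w))) ->
    \int[Q]_w Num.max (wt (A w, B w) - c) 0 <= e ->
    0 <= \int[Q]_w wt (A w, B w) <= c + e.
  move=> mA mB c0 iw le_e; have mw := mwt _ _ _ _ mA mB.
  apply/andP; split; first by apply: Rintegral_ge0 => w _; exact: w0.
  move: le_e.
  rewrite (Rintegral_excess _ _ _ Q _ (fun w => w0 _) mw c c0 iw).
  rewrite lerBlDr => /le_trans; apply; rewrite addrC lerD2r.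
  apply: le_trans (ler_norm _) _.
  apply: Rintegral_bounded; first exact: measurable_cap.
  move=> w; exact: (cap_norm_le _ _ _ _ (fun w => w0 (A w, B w))).
(* The error contains the cube of the mean weight. That mean is bounded by [H], through a level
   fixed before [eta]: the bound read off from the level of [eta] itself could grow as [eta]
   shrinks. *)
have [c1 c10 [[iw le1] near1]] := se 1 ltr01.
pose H := c1 + 1.
have H0 : 0 <= H by rewrite addr_ge0.
(* Only integrability of the kernel is wanted here; the truncation level [0] is arbitrary. *)
have [ik _] := error _ _ P X Y 0 mX mY (lexx 0) iw.
have dcovR : dcov al P X Y =
    (4^-1 * \int[(P \x P \x P \x P)%E]_w ker _ _ X Y id w)%:E.
  by rewrite dcovE (EFin_Rintegral _ _ _ (P \x P \x P \x P)%E).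
rewrite dcovR.
have dcovR_ n : (P_ n).-integrable setT
    (EFin \o (fun w => wt (X_ n w, Y_ n w))) ->
    dcov al (P_ n) (X_ n) (Y_ n) =
    (4^-1 * \int[(P_ n \x P_ n \x P_ n \x P_ n)%E]_w
       ker _ _ (X_ n) (Y_ n) id w)%:E.
  move=> iwn; have [ikn _] := error _ _ (P_ n) _ _ 0 (mX_ n) (mY_ n) (lexx 0) iwn.
  by rewrite dcovE (EFin_Rintegral _ _ _ (P_ n \x P_ n \x P_ n \x P_ n)%E).
(* Convergence in the extended reals: eventual finiteness, then convergence of the real values. *)
apply/fine_cvgP; split.
  by near=> n; rewrite dcovR_//; near: n; apply: filterS near1 => n [].
apply/cvgrPdist_le => e e0.
have D0 : 0 < 16 * K * H ^+ 3 + 1 by rewrite ltr_wpDl// !mulr_ge0// exprn_ge0.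
(* Chosen so that the truncation error [16 * K * eta * H ^+ 3] is at most [e], even if [K = 0]. *)
pose eta := e / (16 * K * H ^+ 3 + 1).
have eta0 : 0 < eta by rewrite divr_gt0.
have etaE : 16 * K * eta * H ^+ 3 <= e.
  have <- : eta * (16 * K * H ^+ 3 + 1) = e by rewrite /eta divfK// gt_eqF.
  by nra.
have [c c0 [[_ le_eta] near_eta]] := se eta eta0.
have small (d' : measure_display) (Om : measurableType d')
    (Q : probability Om R) (A : Om -> TX) (B : Om -> TY) :
    borel_measurable A -> borel_measurable B ->
    Q.-integrable setT (EFin \o (fun w => wt (A w, B w))) ->
    \int[Q]_w Num.max (wt (A w, B w) - c1) 0 <= 1 ->
    \int[Q]_w Num.max (wt (A w, B w) - c) 0 <= eta ->
    `|\int[(Q \x Q \x Q \x Q)%E]_w ker _ _ A B id w -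
      \int[(Q \x Q \x Q \x Q)%E]_w
        ker _ _ A B (Num.min ^~ (cut_level R al c)) w| <= e.
  move=> mA mB iwQ leQ1 leQ.
  have [_ err] := error _ _ Q A B c mA mB c0 iwQ.
  have /andP[m0 mH] := first_moment _ _ Q A B c1 1 mA mB c10 iwQ leQ1.
  apply: le_trans err _; apply: le_trans etaE.
  apply: ler_pM; rewrite ?mulr_ge0 ?exprn_ge0//.
  - by apply: Rintegral_ge0 => w _; rewrite le_max lexx orbT.
  - by rewrite ler_wpM2l// mulr_ge0.
  - by rewrite lerXn2r ?nnegrE.
have hP := small _ _ P X Y mX mY iw le1 le_eta.
have cvgM := cvg_cut_kernel R al TX TY xo yo d Omega P X Y d_ Omega_ P_ X_ Y_
  al0 sepX sepY mX mY mX_ mY_ cvgXY _ (cut_level_ge0 R al c).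
near=> n.
have [iwn le1n] : (P_ n).-integrable setT
    (EFin \o (fun w => wt (X_ n w, Y_ n w))) /\
    \int[P_ n]_w Num.max (wt (X_ n w, Y_ n w) - c1) 0 <= 1 by near: n.
have [_ le_etan] : (P_ n).-integrable setT
    (EFin \o (fun w => wt (X_ n w, Y_ n w))) /\
    \int[P_ n]_w Num.max (wt (X_ n w, Y_ n w) - c) 0 <= eta by near: n.
have hPn := small _ _ (P_ n) _ _ (mX_ n) (mY_ n) iwn le1n le_etan.
have hM : `|\int[(P \x P \x P \x P)%E]_w
      ker _ _ X Y (Num.min ^~ (cut_level R al c)) w -
    \int[(P_ n \x P_ n \x P_ n \x P_ n)%E]_w
      ker _ _ (X_ n) (Y_ n) (Num.min ^~ (cut_level R al c)) w| <= e.
  by near: n; exact: (cvgr_dist_le _ _ cvgM).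
rewrite /= dcovR_//; exact: quarter_dist hP hPn hM.
Unshelve. all: by end_near.
Qed.

End moments.

Theorem theorem4p2 (R : realType) (alpha : R) (TX TY : metricType R)
    (xo : TX) (yo : TY)
    (d : measure_display) (Omega : measurableType d) (P : probability Omega R)
    (X : Omega -> TX) (Y : Omega -> TY)
    (d_ : nat -> measure_display) (Omega_ : forall n, measurableType (d_ n))
    (P_ : forall n, probability (Omega_ n) R)
    (X_ : forall n, Omega_ n -> TX) (Y_ : forall n, Omega_ n -> TY) :
  0 < alpha ->
  separable TX -> separable TY ->
  borel_measurable X -> borel_measurable Y ->
  (forall n, borel_measurable (X_ n)) -> (forall n, borel_measurable (Y_ n)) ->
  cvg_in_distribution P_ (fun n w => (X_ n w, Y_ n w)) P (fun w => (X w, Y w)) ->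
  (uniformly_integrable P_ (fun n w => mdist (X_ n w) xo `^ alpha_star alpha) /\
   uniformly_integrable P_ (fun n w => mdist (Y_ n w) yo `^ alpha_star alpha))
  \/
  ([/\ (fun n => 'E_(P_ n)[fun w => (mdist (X_ n w) xo `^ alpha_star alpha)%R])%E
         @ \oo --> ('E_P[fun w => (mdist (X w) xo `^ alpha_star alpha)%R])%E,
       ('E_P[fun w => (mdist (X w) xo `^ alpha_star alpha)%R] < +oo)%E,
       (fun n => 'E_(P_ n)[fun w => (mdist (Y_ n w) yo `^ alpha_star alpha)%R])%E
         @ \oo --> ('E_P[fun w => (mdist (Y w) yo `^ alpha_star alpha)%R])%E &
       ('E_P[fun w => (mdist (Y w) yo `^ alpha_star alpha)%R] < +oo)%E]) ->
  (fun n => dcov alpha (P_ n) (X_ n) (Y_ n)) @ \oo --> dcov alpha P X Y.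
Proof.
move=> al0 sepX sepY mX mY mX_ mY_ cvgXY ui_or_cvg.
have capX := cvg_capX R alpha TX TY xo d Omega P X Y d_ Omega_ P_ X_ Y_
  al0 mX mX_ cvgXY.
have capY := cvg_capY R alpha TX TY yo d Omega P X Y d_ Omega_ P_ X_ Y_
  al0 mY mY_ cvgXY.
have pX0 w : 0 <= mdist (X w) xo `^ alpha_star alpha by exact: powR_ge0.
have pY0 w : 0 <= mdist (Y w) yo `^ alpha_star alpha by exact: powR_ge0.
have pX0_ n w : 0 <= mdist (X_ n w) xo `^ alpha_star alpha by exact: powR_ge0.
have pY0_ n w : 0 <= mdist (Y_ n w) yo `^ alpha_star alpha by exact: powR_ge0.
have mpX := measurable_moment R _ _ _ X xo (alpha_star alpha) mX.
have mpY := measurable_moment R _ _ _ Y yo (alpha_star alpha) mY.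
have mpX_ n := measurable_moment R _ _ _ (X_ n) xo (alpha_star alpha) (mX_ n).
have mpY_ n := measurable_moment R _ _ _ (Y_ n) yo (alpha_star alpha) (mY_ n).
apply: (cvg_dcov R alpha TX TY xo yo d Omega P X Y d_ Omega_ P_ X_ Y_
  al0 sepX sepY mX mY mX_ mY_ cvgXY).
(* Either condition is used on each marginal separately, and only to produce a small excess. *)
case: ui_or_cvg => [[uiX uiY]|[cvgX ltX cvgY ltY]];
  apply: (moment_small_excess R alpha TX TY xo yo d Omega P X Y d_ Omega_ P_
    X_ Y_ mX mY mX_ mY_).
- exact: (small_excess_of_uniformly_integrable R d Omega P _ d_ Omega_ P_ _
    pX0 pX0_ mpX mpX_ capX uiX).
- exact: (small_excess_of_uniformly_integrable R d Omega P _ d_ Omega_ P_ _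
    pY0 pY0_ mpY mpY_ capY uiY).
- move: cvgX ltX; rewrite unlock.
  exact: (small_excess_of_cvg R d Omega P _ d_ Omega_ P_ _
    pX0 pX0_ mpX mpX_ capX).
- move: cvgY ltY; rewrite unlock.
  exact: (small_excess_of_cvg R d Omega P _ d_ Omega_ P_ _
    pY0 pY0_ mpY mpY_ capY).
Qed.
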